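(* Let $y\in\mathbb{R}$ be fixed and let $A\in\mathbb{R}^{1\times N}$ be random with i.i.d. entries. (1) If the entries of $A$ follow an exponential distribution with parameter $1$, then, for $t>0$, \[\lim_{N\to\infty}\mathbb{P}\left(\tfrac1t<\mathscr{C}_{\mathrm{UL}}(y,A)\right)=\begin{cases}1-e^{-2t}&\text{for }t<|y|,\\1&\text{for }t\ge|y|.\end{cases}\] (2) If the entries of $A$ follow the normal distribution $\mathcal{N}(\mu,\sigma^2)$, then (as $N\to\infty$) $2\sqrt{2\ln(N)}\,[\mathscr{C}_{\mathrm{UL}}(y,A)]^{-1}$ converges in distribution to an exponential random variable with parameter $1/\sigma$. (3) If the entries of $A$ follow the uniform distribution $\mathcal{U}(0,1)$ on $(0,1)$, then (as $N\to\infty$) $2N[\mathscr{C}_{\mathrm{UL}}(y,A)]^{-1}$ converges in distribution to an exponential random variable with parameter $1$.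
   Context: Fix a rational $\lambda>0$ (not depending on $N$). For $(y,A)\in\mathbb{R}^m\times\mathbb{R}^{m\times N}$ (here $m=1$), $\mathsf{Sol}^{\mathsf{UL}}(y,A)=\operatorname{argmin}_{\hat x\in\mathbb{R}^N}\|A\hat x-y\|_2^2+\lambda\|\hat x\|_1$. The stability support $\mathsf{stsp}(y,A)$ is the infimum of all $\delta\ge0$ for which there exist $\tilde y\in\mathbb{R}^m$, $\tilde A\in\mathbb{R}^{m\times N}$, $x\in\mathsf{Sol}^{\mathsf{UL}}(y,A)$, $\tilde x\in\mathsf{Sol}^{\mathsf{UL}}(\tilde y,\tilde A)$ with $\|\tilde y-y\|_\infty\le\delta$, $\|\tilde A-A\|_{\max}\le\delta$ (where $\|M\|_{\max}=\max_{i,j}|M_{ij}|$) and $\mathsf{supp}(x)\ne\mathsf{supp}(\tilde x)$. The condition number is $\mathscr{C}_{\mathrm{UL}}(y,A)=\mathsf{stsp}(y,A)^{-1}$ if $\mathsf{stsp}(y,A)\ne0$ and $\infty$ otherwise, so $[\mathscr{C}_{\mathrm{UL}}(y,A)]^{-1}=\mathsf{stsp}(y,A)$ (with $\infty^{-1}=0$).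
   Formalization: Part (2) is stated for y ≠ 0 (for y = 0 the limit is the constant λ/σ); part (3) is stated for |y| > λ/2 (for |y| < λ/2 the quantity tends to infinity, and for |y| = λ/2 the limit has mean 2|y|/(1+|y|), equal to 1 only if |y| = 1, λ = 2). *)

(* Defs.v *)
From HB Require Import structures.
From mathcomp Require Export all_boot all_order all_algebra.
From mathcomp Require Export all_classical all_reals all_analysis.
Export Order.TTheory GRing.Theory Num.Theory.
Export numFieldNormedType.Exports.

Set Implicit Arguments.
Unset Strict Implicit.
Unset Printing Implicit Defensive.

Local Open Scope classical_set_scope.
Local Open Scope ring_scope.

Section lasso.
Context {R : realType} {m N : nat}.
Implicit Types (lam : R) (y : 'cV[R]_m) (A : 'M[R]_(m, N)) (x : 'cV[R]_N).

Definition l1norm (n : nat) (v : 'cV[R]_n) : R := \sum_i `|v i 0|.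

Definition l2norm (n : nat) (v : 'cV[R]_n) : R :=
  Num.sqrt (\sum_i v i 0 ^+ 2).

Definition lasso_objective lam y A x : R :=
  l2norm (A *m x - y) ^+ 2 + lam * l1norm x.

Definition SolUL lam y A : set 'cV[R]_N :=
  [set x | forall z, lasso_objective lam y A x <= lasso_objective lam y A z].

Definition supp x : {set 'I_N} := [set j | x j 0 != 0]%SET.

(* [mx_norm] is the entrywise maximum norm, for the column vectors as well.
   The infimum is taken in the extended reals: it is +oo when no perturbation
   whatsoever changes the support (which requires m = 0 or N = 0). *)
Definition stsp lam y A : \bar R :=
  ereal_inf [set delta%:E | delta in [set delta : R | 0 <= delta /\
    exists (y' : 'cV[R]_m) (A' : 'M[R]_(m, N)) (x x' : 'cV[R]_N),
      [/\ SolUL lam y A x, SolUL lam y' A' x',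
          mx_norm (y' - y) <= delta, mx_norm (A' - A) <= delta
        & supp x != supp x'] ]].

(* The inverse on [\bar R] satisfies (+oo)^-1 = 0. *)
Definition condUL lam y A : \bar R :=
  if stsp lam y A != 0%E then ((stsp lam y A)^-1)%E else +oo%E.

End lasso.

Definition mutually_independent d (T : measurableType d) (R : realType)
    (P : probability T R) (I : finType) (X : I -> {RV P >-> R}) : Prop :=
  forall (J : {set I}) (B : I -> set R), (forall i, measurable (B i)) ->
    P (\bigcap_(i in [set` J]) (X i @^-1` B i)) =
    (\prod_(i in J) P (X i @^-1` B i))%E.

Definition iid_with_law d (T : measurableType d) (R : realType)
    (P : probability T R) (I : finType) (X : I -> {RV P >-> R})
    (mu : set R -> \bar R) : Prop :=
  mutually_independent X /\
  forall i (B : set R), measurable B -> distribution P (X i) B = mu B.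

Definition random_row d (T : measurableType d) (R : realType)
    (P : probability T R) (N : nat) (X : 'I_N -> {RV P >-> R}) (w : T) :
    'M[R]_(1, N) := \row_j X j w.

(* Convergence of the distribution functions at every continuity point of the
   limiting one.  The X n are allowed to take infinite values (such values are
   never counted as being below a real r at +oo), and each X n may live on its
   own probability space; mu is a probability law on R. *)
Definition cvg_in_distribution (R : realType) (d : nat -> measure_display)
    (T : forall n, measurableType (d n)) (P : forall n, probability (T n) R)
    (X : forall n, T n -> \bar R) (mu : set R -> \bar R) : Prop :=
  forall r : R, {for r, continuous (fun s : R => mu `]-oo, s]%classic)} ->
    P n [set w | (X n w <= r%:E)%E] @[n --> \oo] --> mu `]-oo, r]%classic.

(* Main.v *)
From HB Require Import structures.
Require Import Defs.
From mathcomp Require Import measurable_realfun ring lra.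

Set Implicit Arguments.
Unset Strict Implicit.
Unset Printing Implicit Defensive.

Local Open Scope classical_set_scope.
Local Open Scope ring_scope.

(** With one measurement, write M for the largest of the |a_j|.  If
    2 M |y| <= lam the only minimiser is 0; otherwise the minimisers are supported
    on the indices with |a_j| = M, and each such index alone supports one.  So,
    once M is large, a perturbation of size t < |y| changes the support exactly
    when the gap between the two largest |a_j| is at most 2 t.

    Let Y_j be the largest |a_i| with i <> j, which is independent of a_j.  The
    gap exceeds s on the disjoint union of the events |a_j| > Y_j + s, while the
    events |a_j| > Y_j exhaust the space up to ties.  Hence, conditioning on
    Y_j, a comparison between the tails P(|a| > y + s) and P(|a| > y), uniform
    in the relevant range of y, is a bound on the distribution of the gap. *)

(** How large M must be shapes the hypotheses. The gap decides alone only if shrinking [y] and the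
    whole row by the perturbation cannot bring [2 M |y|] down to [lam]. This asks M to exceed a
    fixed threshold, which the largest of N entries does with probability tending to 1 as soon as
    one entry may exceed it. For unbounded laws and [y != 0] every threshold qualifies. For the
    uniform law M stays below 1, whence [lam / 2 < |y|]: if [|y| < lam / 2], the stability support
    stays away from 0. If [y = 0], it is governed by M and not by the gap.

    The laws differ in how exact the tail comparison is. For the exponential law the ratio of tails
    is the same at every level. For the uniform law the comparison is exact once the tail is cut at
    [U = 1 - s]. For the normal law the ratio depends on the level and is close to its limit only
    near [sigma * sqrt (2 ln N)]. Hence two truncations: the lower bound keeps only maxima below
    some U, at the price of a factor [F U ^ N] tending to 1, and the upper bound ignores levels
    below some L, at the price of a term [F (L + s) ^ N] tending to 0. *)

Lemma mx_norm_leP (R : realType) m n (A : 'M[R]_(m, n)) (c : R) : 0 <= c ->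
  (mx_norm A <= c) <-> (forall i j, `|A i j| <= c).
Proof.
move=> c0; rewrite mx_normrE; split.
  by move=> /bigmax_leP[_ h] i j; exact: (h (i, j)).
by move=> h; apply/bigmax_leP; split => // -[i j] _; exact: h.
Qed.

(** * The largest modulus in a row *)

Section abs_max.
Context {R : realType} {N : nat}.
Implicit Types (a : 'rV[R]_N) (j : 'I_N) (c : R).

Definition amax a : R := \big[Num.max/0]_j `|a 0 j|.

Lemma amax_ge0 a : 0 <= amax a.
Proof. exact: bigmax_ge_id. Qed.

Lemma le_amax a j : `|a 0 j| <= amax a.
Proof. exact: (le_bigmax 0 (fun j => `|a 0 j|)). Qed.

Lemma amax_le a c : 0 <= c -> (forall j, `|a 0 j| <= c) -> amax a <= c.
Proof. by move=> c0 h; apply/bigmax_leP; split. Qed.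

Lemma amax_arg a : (0 < N)%N -> exists j, `|a 0 j| = amax a.
Proof.
move=> N0; pose j0 : 'I_N := Ordinal N0.
exists [arg max_(i > j0 | true) `|a 0 i|]%O.
by rewrite /amax (@bigmax_eq_arg _ _ _ _ j0).
Qed.

Lemma amax_gt0_arg a : 0 < amax a -> exists j, `|a 0 j| = amax a.
Proof.
move=> a0; apply: amax_arg; rewrite lt0n; apply/negP => /eqP N0.
move: a0; rewrite ltNge amax_le// => j.
by have := ltn_ord j; rewrite [X in (_ < X)%N]N0.
Qed.

End abs_max.

(** Gives [u] the modulus [v] without changing its sign, which is the cheapest way to do so. The
    perturbations of entries built below have this form, so signs never enter the estimates. *)
Definition setabs {R : realType} (u v : R) : R := if u < 0 then - v else v.

Lemma normr_setabs (R : realType) (u v : R) : 0 <= v -> `|setabs u v| = v.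
Proof. by move=> v0; rewrite /setabs; case: ifP; rewrite ?normrN ger0_norm. Qed.

Lemma normr_setabsB (R : realType) (u v : R) : `|setabs u v - u| = `|v - `|u| |.
Proof.
rewrite /setabs; case: ltP => u0; last by rewrite (ger0_norm u0).
by rewrite (ltr0_norm u0) -normrN opprB !opprK addrC.
Qed.

(** * Minimisers for a single measurement *)

Section lasso_row.
Context {R : realType} {N : nat}.
Variable lam : R.
Hypothesis lam_gt0 : 0 < lam.
Implicit Types (y : 'cV[R]_1) (a : 'rV[R]_N) (x z : 'cV[R]_N).

Lemma l1norm_ge0 x : 0 <= l1norm x.
Proof. by apply: sumr_ge0 => i _. Qed.

Lemma l1norm_eq0 x : l1norm x = 0 -> x = 0.
Proof.
move=> x0; apply/matrixP => i j; rewrite ord1 mxE; apply/eqP.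
have /eqP := x0; rewrite psumr_eq0// => /allP /(_ i).
by rewrite mem_index_enum normr_eq0 => /(_ isT).
Qed.

Lemma lasso_objectiveE y a x : lasso_objective lam y a x =
  ((a *m x) 0 0 - y 0 0) ^+ 2 + lam * l1norm x.
Proof.
rewrite /lasso_objective /l2norm big_ord_recl big_ord0 addr0 sqr_sqrtr ?sqr_ge0//.
by rewrite !mxE.
Qed.

Lemma dot_le a x : `|(a *m x) 0 0| <= \sum_j `|a 0 j| * `|x j 0|.
Proof.
rewrite mxE; apply: le_trans (ler_norm_sum _ _ _) _.
by apply: ler_sum => j _; rewrite normrM.
Qed.

Lemma dot_le_amax a x : \sum_j `|a 0 j| * `|x j 0| <= amax a * l1norm x.
Proof.
rewrite /l1norm mulr_sumr; apply: ler_sum => j _.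
by rewrite ler_wpM2r// le_amax.
Qed.

(** Hölder's inequality bounds the cross term of the expanded square by [lam * l1norm z], so the
    objective at [z] is at least [y^2 + (a z)^2]. The surviving square [(a z)^2] is what keeps 0 the
    only minimiser in the boundary case of equality. *)
Lemma solUL_small y a : 2 * amax a * `|y 0 0| <= lam ->
  forall x, SolUL lam y a x <-> x = 0.
Proof.
move=> small x.
have key z : y 0 0 ^+ 2 + (a *m z) 0 0 ^+ 2 <= lasso_objective lam y a z.
  rewrite lasso_objectiveE.
  have h1 := le_trans (dot_le a z) (dot_le_amax a z).
  have h2 : (a *m z) 0 0 * y 0 0 <= amax a * l1norm z * `|y 0 0|.
    apply: le_trans (ler_norm _) _; rewrite normrM.
    by rewrite ler_wpM2r.
  have h3 : 2 * amax a * `|y 0 0| * l1norm z <= lam * l1norm z.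
    by rewrite ler_wpM2r// l1norm_ge0.
  by rewrite sqrrB; nra.
have obj0 : lasso_objective lam y a 0 = y 0 0 ^+ 2.
  rewrite lasso_objectiveE mulmx0 mxE sub0r sqrrN /l1norm big1 ?mulr0 ?addr0//.
  by move=> i _; rewrite mxE normr0.
split=> [/(_ 0)|-> z].
  rewrite obj0 => hx; have := key x.
  have dot0 : (a *m x) 0 0 = 0.
    apply/eqP; rewrite -sqrf_eq0 eq_le sqr_ge0 andbT.
    by have := key x; lra.
  move: hx; rewrite lasso_objectiveE dot0 sub0r sqrrN => hx _.
  apply: l1norm_eq0; apply/eqP; rewrite eq_le l1norm_ge0 andbT.
  by rewrite -(ler_pM2l lam_gt0) mulr0; lra.
by rewrite obj0; apply: le_trans (key z); rewrite lerDl sqr_ge0.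
Qed.

Section large.
Variables (y : 'cV[R]_1) (a : 'rV[R]_N).
Hypothesis large : lam < 2 * amax a * `|y 0 0|.
Let M := amax a.
(** The soft-thresholded measurement: the common value of [|a x|] over all minimisers [x]. *)
Let tau := `|y 0 0| - lam / (2 * M).

Lemma amax_gt0_large : 0 < M.
Proof.
rewrite lt_neqAle amax_ge0 andbT; apply/negP => /eqP M0.
by move: large lam_gt0; rewrite -/M -M0; lra.
Qed.
Let M0 := amax_gt0_large.

Let tau_gt0 : 0 < tau.
Proof.
rewrite subr_gt0 ltr_pdivrMr; first by move: large; rewrite -/M; lra.
by rewrite mulr_gt0.
Qed.

Let lamE : lam = 2 * M * (`|y 0 0| - tau).
Proof. by rewrite /tau opprB addrC subrK mulrC divfK// mulf_neq0 ?gt_eqF// M0. Qed.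

(** The optimal value [y^2 - tau^2] plus three nonnegative terms. They vanish when [|a z| = tau],
    when [a z] and [y] do not have opposite signs, and when Hölder's inequality for [a] and [z] is
    an equality. This describes all minimisers at once. *)
Let obj_decomp z : lasso_objective lam y a z = y 0 0 ^+ 2 - tau ^+ 2
    + (`|(a *m z) 0 0| - tau) ^+ 2
    + 2 * (`|(a *m z) 0 0| * `|y 0 0| - (a *m z) 0 0 * y 0 0)
    + 2 * (`|y 0 0| - tau) * (M * l1norm z - `|(a *m z) 0 0|).
Proof.
rewrite lasso_objectiveE lamE; set s := (a *m z) 0 0.
have := real_normK (num_real s); rewrite expr2 => sE.
by ring: sE.
Qed.

Let ytau_gt0 : 0 < `|y 0 0| - tau.
Proof. by rewrite /tau opprB addrC subrK divr_gt0// mulr_gt0. Qed.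

Let optimal_at j : `|a 0 j| = M ->
  exists2 x, lasso_objective lam y a x = y 0 0 ^+ 2 - tau ^+ 2
    & supp x = [set j]%SET.
Proof.
move=> ajM.
have aj0 : a 0 j != 0 by rewrite -normr_gt0 ajM.
(* The only nonzero coordinate is tuned so that [a x] has modulus [tau] and the sign of [y]; placing
   it on an index of maximal modulus makes Hölder's inequality tight. *)
pose v := setabs (y 0 0) tau / a 0 j.
pose x : 'cV[R]_N := \col_i (if i == j then v else 0).
have v0 : v != 0.
  by rewrite -normr_gt0 normrM normrV ?unitfE// normr_setabs ?ltW// divr_gt0// ajM.
have xE : (a *m x) 0 0 = setabs (y 0 0) tau.
  rewrite mxE (bigD1 j)//= mxE eqxx big1 ?addr0; first by rewrite mulrC divfK.
  by move=> i ij; rewrite mxE (negbTE ij) mulr0.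
have l1x : M * l1norm x = tau.
  rewrite /l1norm (bigD1 j)//= mxE eqxx big1; last first.
    by move=> i ij; rewrite mxE (negbTE ij) normr0.
  rewrite addr0 -ajM normrM normrV ?unitfE// normr_setabs ?ltW//.
  by rewrite mulrC divfK// normr_eq0.
have ys : setabs (y 0 0) tau * y 0 0 = tau * `|y 0 0|.
  rewrite /setabs; case: ltP => y0; last by rewrite ger0_norm.
  by rewrite ltr0_norm// mulNr mulrN.
exists x; last first.
  apply/setP => i; rewrite !inE mxE.
  by case: (eqVneq i j) => // _; rewrite eqxx.
rewrite obj_decomp l1x xE normr_setabs ?ltW// ys !subrr expr0n/=.
by rewrite !mulr0 !addr0.
Qed.

Let obj_gap z : [/\ 0 <= (`|(a *m z) 0 0| - tau) ^+ 2,
    0 <= `|(a *m z) 0 0| * `|y 0 0| - (a *m z) 0 0 * y 0 0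
  & 0 <= (`|y 0 0| - tau) * (M * l1norm z - `|(a *m z) 0 0|)].
Proof.
split; first exact: sqr_ge0.
  by rewrite subr_ge0 -normrM ler_norm.
rewrite mulr_ge0 ?(ltW ytau_gt0)// subr_ge0.
exact: le_trans (dot_le a z) (dot_le_amax a z).
Qed.

Lemma solUL_large_at j : `|a 0 j| = M ->
  exists2 x, SolUL lam y a x & supp x = [set j]%SET.
Proof.
move=> /optimal_at[x xopt xj]; exists x => // z.
rewrite xopt obj_decomp; have [] := obj_gap z; lra.
Qed.

(** At a minimiser all three terms of [obj_decomp] vanish. Then [tau > 0] rules out [x = 0], and
    equality in Hölder's inequality allows weight only where [|a_j| = M]. *)
Lemma solUL_large_supp x : SolUL lam y a x ->
  supp x != finset.set0 /\ (forall j, j \in supp x -> `|a 0 j| = M).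
Proof.
have [j0 /optimal_at[z zopt _]] := amax_gt0_arg M0.
move=> /(_ z); rewrite zopt obj_decomp => xle.
have [h1 h2 h3] := obj_gap x.
have /eqP : (`|(a *m x) 0 0| - tau) ^+ 2 = 0 by lra.
rewrite sqrf_eq0 subr_eq0 => /eqP s_tau.
have /eqP : (`|y 0 0| - tau) * (M * l1norm x - `|(a *m x) 0 0|) = 0 by lra.
rewrite mulf_eq0 (gt_eqF ytau_gt0)/= subr_eq0 => /eqP sM.
(* [M * l1norm x = |a x|] is at most the sum of the [|a_j| |x_j|], so a sum of nonnegative slacks is
   at most 0. *)
have slack : \sum_j (M - `|a 0 j|) * `|x j 0| = 0.
  apply/eqP; rewrite eq_le; apply/andP; split; last first.
    by apply: sumr_ge0 => j _; rewrite mulr_ge0// subr_ge0 le_amax.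
  under eq_bigr do rewrite mulrBl.
  rewrite sumrB -mulr_sumr -/(l1norm x) sM subr_le0.
  exact: dot_le.
split.
  apply/negP => /eqP x0; move: tau_gt0; rewrite -s_tau.
  rewrite mxE big1 ?normr0 ?ltxx// => j _.
  have : j \notin supp x by rewrite x0 inE.
  by rewrite inE negbK => /eqP ->; rewrite mulr0.
move=> j; rewrite inE => xj; move/eqP: slack.
rewrite psumr_eq0; last first.
  by move=> i _; rewrite mulr_ge0// subr_ge0 le_amax.
move=> /allP /(_ j); rewrite mem_index_enum mulf_eq0 normr_eq0 (negbTE xj) orbF.
by rewrite subr_eq0 => /(_ isT) /eqP.
Qed.

End large.
End lasso_row.

(** * The stability support *)

Section stability_support.
Context {R : realType} {N : nat}.
Variable lam : R.
Hypothesis lam_gt0 : 0 < lam.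
Hypothesis N_gt0 : (0 < N)%N.
Implicit Types (y delta : R) (a : 'rV[R]_N).

Definition adm y a : set R := [set delta | 0 <= delta /\
  exists (y' : 'cV[R]_1) (a' : 'rV[R]_N) (x x' : 'cV[R]_N),
    [/\ SolUL lam (const_mx y) a x, SolUL lam y' a' x',
        mx_norm (y' - const_mx y) <= delta, mx_norm (a' - a) <= delta
      & supp x != supp x'] ].

Lemma stspE y a :
  stsp lam (const_mx y) a = ereal_inf [set delta%:E | delta in adm y a].
Proof. by []. Qed.

Lemma supp0 : supp (0 : 'cV[R]_N) = finset.set0.
Proof. by apply/setP => i; rewrite !inE mxE eqxx. Qed.

Lemma amax_lip a a' delta : 0 <= delta -> mx_norm (a' - a) <= delta ->
  amax a' <= amax a + delta.
Proof.
move=> d0 /mx_norm_leP => /(_ d0) h.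
apply: amax_le => [|j]; first by rewrite addr_ge0// amax_ge0.
have := h 0 j; rewrite !mxE => hj.
have -> : a' 0 j = a 0 j + (a' 0 j - a 0 j) by rewrite addrC subrK.
by apply: le_trans (ler_normD _ _) _; rewrite lerD// le_amax.
Qed.

Lemma rV1_lip y (y' : 'cV[R]_1) delta : 0 <= delta ->
  mx_norm (y' - const_mx y) <= delta -> `|y' 0 0 - y| <= delta.
Proof. by move=> d0 /mx_norm_leP => /(_ d0 0 0); rewrite !mxE. Qed.

Lemma setabs_mx_norm a (f : R -> R) delta : 0 <= delta ->
  (forall j, `|f (a 0 j) - `|a 0 j| | <= delta) ->
  mx_norm (\row_j setabs (a 0 j) (f (a 0 j)) - a) <= delta.
Proof.
move=> d0 h; apply/mx_norm_leP => // i j; rewrite ord1 !mxE normr_setabsB.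
exact: h.
Qed.

Lemma setabs_cV_norm y (v delta : R) : 0 <= delta -> `|v - `|y| | <= delta ->
  mx_norm (const_mx (setabs y v) - const_mx y : 'cV[R]_1) <= delta.
Proof.
by move=> d0 h; apply/mx_norm_leP => // i j; rewrite !mxE normr_setabsB.
Qed.

(** The best attempt at a nonzero minimiser enlarges every [|a_j|] and [|y|] by [delta]. The
    inequality is strict because 0 is still the only minimiser on the boundary. *)
Lemma adm_small y a delta : 2 * amax a * `|y| <= lam ->
  adm y a delta <-> 0 <= delta /\ lam < 2 * (amax a + delta) * (`|y| + delta).
Proof.
move=> small.
have small' : 2 * amax a * `|(const_mx y : 'cV[R]_1) 0 0| <= lam by rewrite mxE.
split=> -[d0].
  move=> [y' [a' [x [x' [/(solUL_small lam_gt0 small') -> solx' yy aa xx']]]]].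
  split=> //; rewrite ltNge; apply/negP => le_lam.
  have small2 : 2 * amax a' * `|y' 0 0| <= lam.
    apply: le_trans le_lam; apply: ler_pM => //.
    - by rewrite mulr_ge0// amax_ge0.
    - by rewrite ler_pM2l// (amax_lip d0).
    - have -> : y' 0 0 = y + (y' 0 0 - y) by rewrite addrC subrK.
      by apply: le_trans (ler_normD _ _) _; rewrite lerD// rV1_lip.
  by move: xx'; rewrite (solUL_small lam_gt0 small2 x').1// eqxx.
move=> lt_lam; split=> //.
pose a' : 'rV[R]_N := \row_j setabs (a 0 j) (`|a 0 j| + delta).
pose y' : 'cV[R]_1 := const_mx (setabs y (`|y| + delta)).
have large : lam < 2 * amax a' * `|y' 0 0|.
  apply: lt_le_trans lt_lam _; rewrite mxE normr_setabs ?addr_ge0//.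
  rewrite ler_wpM2r ?addr_ge0// ler_pM2l//.
  have [j <-] := amax_arg a N_gt0.
  by apply: le_trans (le_amax _ j); rewrite mxE normr_setabs ?addr_ge0.
have [j ja'] := amax_gt0_arg (amax_gt0_large lam_gt0 large).
have [x' x'sol x'j] := solUL_large_at lam_gt0 large ja'.
exists y', a', 0, x'; split => //.
- exact/(solUL_small lam_gt0 small').
- by apply: setabs_cV_norm => //; rewrite addrAC subrr add0r ger0_norm.
- apply: (setabs_mx_norm (f := fun u => `|u| + delta)) => // i.
  by rewrite addrAC subrr add0r ger0_norm.
- rewrite supp0 x'j; apply/eqP => /setP /(_ j).
  by rewrite !inE eqxx.
Qed.

(** The factor 2 appears because the leader can be lowered by [delta] while its challenger is raised
    by [delta]. *)
Definition near_tie a delta := exists i j,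
  [/\ i != j, `|a 0 j| = amax a & amax a - 2 * delta <= `|a 0 i|].

(** The support changes either because another index catches up, or because shrinking everything
    makes 0 the only minimiser. The cases [|y| <= delta] and [amax a <= delta] stand apart since
    shrinking stops at 0, whereas a product of two negative factors could exceed [lam]. *)
Lemma adm_large y a delta : lam < 2 * amax a * `|y| ->
  adm y a delta <-> 0 <= delta /\
  (near_tie a delta \/
   [\/ `|y| <= delta, amax a <= delta
     | 2 * (amax a - delta) * (`|y| - delta) <= lam]).
Proof.
move=> large.
have large' : lam < 2 * amax a * `|(const_mx y : 'cV[R]_1) 0 0| by rewrite mxE.
split=> -[d0].
  move=> [y' [a' [x [x' [solx solx' yy aa xx']]]]]; split=> //.
  apply: contrapT => /not_orP[ntie nlam].
  have {nlam}[yd ad lam_lt] : [/\ delta < `|y|, delta < amax a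
      & lam < 2 * (amax a - delta) * (`|y| - delta)].
    split; rewrite ltNge; apply/negP => h; apply: nlam.
    - exact: Or31.
    - exact: Or32.
    - exact: Or33.
  have aM' : amax a - delta <= amax a'.
    rewrite lerBlDr; apply: amax_lip => //; apply/mx_norm_leP => // i k; rewrite !mxE distrC.
    by have /(mx_norm_leP _ d0) /(_ i k) := aa; rewrite !mxE.
  have large2 : lam < 2 * amax a' * `|y' 0 0|.
    apply: lt_le_trans lam_lt _; apply: ler_pM.
    - by rewrite mulr_ge0// subr_ge0 ltW.
    - by rewrite subr_ge0 ltW.
    - by rewrite ler_pM2l.
    - have := rV1_lip d0 yy; rewrite lerBlDr distrC => yyd.
      have {1}-> : y = (y - y' 0 0) + y' 0 0 by rewrite subrK.
      by apply: le_trans (ler_normD _ _) _; rewrite addrC lerD2l.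
  have [x0 xs] := solUL_large_supp lam_gt0 large' solx.
  have [x'0 x's] := solUL_large_supp lam_gt0 large2 solx'.
  have [j jx] := set0Pn _ x0.
  (* Without a near tie [j] is the only maximal index of [a], and any maximal index of [a'] would
     have modulus at least [amax a - 2 * delta] in [a]. Both supports are therefore the singleton of
     [j]. *)
  have uniq_arg i : i != j -> `|a 0 i| < amax a - 2 * delta.
    move=> ij; rewrite ltNge; apply/negP => h; apply: ntie.
    by exists i, j; rewrite ij (xs _ jx).
  have xE : supp x = [set j]%SET.
    apply/setP => i; rewrite !inE; have [->|ij] := eqVneq i j.
      by have := jx; rewrite inE.
    apply/negbTE/negP => h; have := uniq_arg _ ij.
    by rewrite xs ?inE// ltNge lerBlDr lerDl mulr_ge0.
  have x'sub i : i \in supp x' -> i = j.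
    move=> /x's iM; apply/eqP; apply/negPn/negP => /uniq_arg; rewrite ltNge.
    move=> /negP; apply; rewrite lerBlDr (_ : 2 * delta = delta + delta); last first.
      by rewrite -mulr2n mulr_natl.
    rewrite addrA -lerBlDr (le_trans aM')// -iM.
    have -> : a' 0 i = a 0 i + (a' 0 i - a 0 i) by rewrite addrC subrK.
    apply: le_trans (ler_normD _ _) _; rewrite lerD2l.
    by have /(mx_norm_leP _ d0) /(_ 0 i) := aa; rewrite !mxE.
  have x'E : supp x' = [set j]%SET.
    have [i' i'x'] := set0Pn _ x'0.
    apply/setP => i; rewrite finset.in_set1; apply/idP/eqP => [/x'sub//|->].
    by rewrite -(x'sub _ i'x').
  by move: xx'; rewrite xE x'E eqxx.
case=> [[i [j [ij jM iM]]]|].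
  (* Levelling at the midpoint: entries above [mid] are cut down to it and entry [i] is raised to
     it, which makes [i] maximal. No entry moves by more than half the gap, that is, by more than
     [delta]. *)
  pose mid := (amax a + `|a 0 i|) / 2.
  have iaM : `|a 0 i| <= amax a by exact: le_amax.
  have mid0 : 0 <= mid by rewrite divr_ge0// addr_ge0// amax_ge0.
  pose a' : 'rV[R]_N := \row_k
    if (k == i) || (mid < `|a 0 k|) then setabs (a 0 k) mid else a 0 k.
  split=> //.
  have a'M : amax a' = mid.
    apply/eqP; rewrite eq_le; apply/andP; split.
      apply: amax_le => // k; rewrite mxE; case: ifPn.
        by rewrite normr_setabs.
      by rewrite negb_or -leNgt => /andP[].
    by rewrite (le_trans _ (le_amax _ i))// mxE eqxx/= normr_setabs.
  have a'i : `|a' 0 i| = amax a' by rewrite a'M mxE eqxx/= normr_setabs.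
  have [x solx xj] := solUL_large_at lam_gt0 large' jM.
  (* If levelling leads into the regime where 0 is the only minimiser, the new support is empty;
     otherwise it can be chosen as the singleton of [i]. Neither is the singleton of [j]. *)
  have [x' solx' x'i] : exists2 x', SolUL lam (const_mx y) a' x'
      & supp x' = finset.set0 \/ supp x' = [set i]%SET.
    have [small|large2] := leP (2 * amax a' * `|(const_mx y : 'cV[R]_1) 0 0|) lam.
      exists 0; last by left; exact: supp0.
      exact/(solUL_small lam_gt0 small).
    have [x' ? ?] := solUL_large_at lam_gt0 large2 a'i.
    by exists x' => //; right.
  exists (const_mx y), a', x, x'; split => //.
  - by rewrite subrr; apply/mx_norm_leP => // ? ?; rewrite mxE normr0.
  - apply/mx_norm_leP => // ? k; rewrite ord1 !mxE; case: ifPn => [|_]; last first.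
      by rewrite subrr normr0.
    rewrite normr_setabsB ler_norml /mid => /orP[/eqP ->|mk].
      by apply/andP; split; lra.
    have := le_amax a k; move: mk; rewrite /mid => ? ?.
    by apply/andP; split; lra.
  - rewrite xj; case: x'i => ->; apply/eqP => /setP /(_ j); rewrite !inE eqxx//.
    by rewrite eq_sym (negbTE ij).
move=> h; split=> //.
(* Shrinkage of a modulus by [delta], stopped at 0. *)
pose f (u : R) : R := Num.max (`|u| - delta) 0.
have f0 u : 0 <= f u by rewrite le_max lexx orbT.
have fB u : `|f u - `|u| | <= delta.
  have u0 := normr_ge0 u.
  by rewrite ler_norml /f maxEle; case: (lerP (`|u| - delta) 0) => ud; apply/andP; split; lra.
pose a' : 'rV[R]_N := \row_j setabs (a 0 j) (f (a 0 j)).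
pose y' : 'cV[R]_1 := const_mx (setabs y (f y)).
have a'M : amax a' <= Num.max (amax a - delta) 0.
  apply: amax_le => [|j]; first by rewrite le_max lexx orbT.
  rewrite mxE normr_setabs// /f ge_max le_max lerD2r le_amax/=.
  by rewrite le_max lexx orbT.
have small : 2 * amax a' * `|y' 0 0| <= lam.
  rewrite mxE normr_setabs//.
  apply: (@le_trans _ _ (2 * Num.max (amax a - delta) 0 * f y)).
    by rewrite ler_wpM2r// ler_pM2l.
  have maxr0 v : v <= delta -> Num.max (v - delta) 0 = 0.
    by move=> vd; apply/max_idPr; rewrite subr_le0.
  have maxl0 v : delta < v -> Num.max (v - delta) 0 = v - delta.
    by move=> vd; apply/max_idPl; rewrite subr_ge0 ltW.
  rewrite /f; case: (leP (amax a) delta) => aM.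
    by rewrite maxr0// mulr0 mul0r ltW.
  case: (leP `|y| delta) => yd.
    by rewrite [X in _ * X]maxr0// mulr0 ltW.
  rewrite !maxl0//; case: h => //; first by rewrite leNgt yd.
  by rewrite leNgt aM.
have [j ja] := amax_gt0_arg (amax_gt0_large lam_gt0 large').
have [x xsol xj] := solUL_large_at lam_gt0 large' ja.
exists y', a', x, 0; split => //.
- exact/(solUL_small lam_gt0 small).
- exact: setabs_cV_norm.
- exact: setabs_mx_norm.
- rewrite supp0 xj; apply/eqP => /setP /(_ j).
  by rewrite !inE eqxx.
Qed.

End stability_support.

(** * The condition number in terms of the gap *)

Section condition_number.
Context {R : realType} {N : nat}.
Variable lam : R.
Hypothesis lam_gt0 : 0 < lam.
Implicit Types (y delta t r tau : R) (a : 'rV[R]_N) (j : 'I_N).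

Definition amax_but a j : R := \big[Num.max/0]_(i | i != j) `|a 0 i|.

Lemma amax_but_ge0 a j : 0 <= amax_but a j.
Proof. exact: bigmax_ge_id. Qed.

Lemma le_amax_but a i j : i != j -> `|a 0 i| <= amax_but a j.
Proof. exact: (le_bigmax_cond 0 (fun i => `|a 0 i|)). Qed.

Lemma amax_but_le_amax a j : amax_but a j <= amax a.
Proof.
by apply/bigmax_leP; split => [|i _]; [exact: amax_ge0 | exact: le_amax].
Qed.

Lemma amax_but_arg a j : (1 < N)%N -> exists2 i, i != j & `|a 0 i| = amax_but a j.
Proof.
move=> N1.
have [i0 i0j] : exists i0 : 'I_N, i0 != j.
  apply/existsP; rewrite -negb_forall; apply/negP => /forallP h.
  move: N1; rewrite -[X in (_ < X)%N]card_ord ltnNge => /negP; apply.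
  by apply/card_le1_eqP => i k _ _; rewrite (eqP (h i)) (eqP (h k)).
have := @bigmax_eq_arg _ R _ 0 i0 (fun i => i != j) (fun i => `|a 0 i|) i0j.
move=> /(_ (fun _ _ => normr_ge0 _)); rewrite -/(amax_but a j) => ->.
by case: arg_maxP => // i ij _; exists i.
Qed.

(** An index can strictly exceed its [amax_but] only if it is the unique leader. The condition
    [1 < N] makes [amax_but] the modulus of an actual competitor and not merely the seed 0. *)
Lemma near_tieP a delta : (1 < N)%N -> 0 <= delta ->
  near_tie a delta <-> ~ exists j, amax_but a j + 2 * delta < `|a 0 j|.
Proof.
move=> N1 d0; split.
  move=> [i [j [ij jM iM]]] [k]; have [->|kj] := eqVneq k j.
    by have := le_amax_but a ij; lra.
  have := le_amax a k; rewrite eq_sym in kj; have := le_amax_but a kj; lra.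
move=> nk; have [j jM] := amax_arg a (ltnW N1).
have [i ij iY] := amax_but_arg a j N1.
exists i, j; split=> //; rewrite iY -jM lerBlDr leNgt; apply/negP => h.
by apply: nk; exists j.
Qed.

Lemma stsp_ltP y a t : (stsp lam (const_mx y) a < t%:E)%E ->
  exists2 delta, adm lam y a delta & delta < t.
Proof.
rewrite stspE => /ereal_inf_lt[_ [delta ad <-]].
by rewrite lte_fin => dt; exists delta.
Qed.

Lemma stsp_le y a delta : adm lam y a delta ->
  (stsp lam (const_mx y) a <= delta%:E)%E.
Proof. by move=> ad; rewrite stspE; apply: ereal_inf_lbound; exists delta. Qed.

Lemma stsp_ge0 y a : (0 <= stsp lam (const_mx y) a)%E.
Proof.
by rewrite stspE; apply: le_ereal_inf_tmp => _ [delta [d0 _] <-]; rewrite lee_fin.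
Qed.

(** The case distinction in [condUL] disappears because the inverse of 0 on the extended reals is
    +oo. *)
Lemma condULE y a :
  condUL lam (const_mx y) a = ((stsp lam (const_mx y) a)^-1)%E.
Proof. by rewrite /condUL; case: eqVneq => // ->; rewrite inve0. Qed.

Lemma condUL_gtE y a t : 0 < t ->
  ((1 / t)%:E < condUL lam (const_mx y) a)%E =
  (stsp lam (const_mx y) a < t%:E)%E.
Proof.
move=> t0; rewrite condULE inve_pgt ?inE ?stsp_ge0//; last first.
  by rewrite lee_fin divr_ge0// ltW.
by rewrite inver div1r invr_eq0 (gt_eqF t0) invrK.
Qed.

Lemma condULV y a :
  ((condUL lam (const_mx y) a)^-1)%E = stsp lam (const_mx y) a.
Proof. by rewrite condULE inveK. Qed.

(** Even shrinking by [tau] leaves the row in the regime of nonzero minimisers, so up to size [tau]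
    only near ties can change the support. *)
Definition robust y a tau :=
  [/\ tau < `|y|, tau < amax a & lam < 2 * (amax a - tau) * (`|y| - tau)].

(** The threshold results from solving the last condition of [robust] for [amax a]. It does not
    depend on the row, so it can be fixed before [N] tends to infinity. *)
Lemma amax_robust y a tau : tau < `|y| -> 0 <= tau ->
  tau + lam / (2 * (`|y| - tau)) < amax a -> robust y a tau.
Proof.
move=> ty t0 h; have yt : 0 < `|y| - tau by rewrite subr_gt0.
have q0 : 0 < lam / (2 * (`|y| - tau)) by rewrite divr_gt0// mulr_gt0.
split=> //; first by lra.
move: h; rewrite -ltrBrDl ltr_pdivrMr ?mulr_gt0//.
by lra.
Qed.

Lemma adm_robust y a tau delta : robust y a tau -> 0 <= delta <= tau ->
  adm lam y a delta <-> near_tie a delta.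
Proof.
move=> [ty tM lt_lam] /andP[d0 dt].
have large : lam < 2 * amax a * `|y|.
  have t0 := le_trans d0 dt; have := mulr_ge0 t0 (normr_ge0 y).
  have : 0 <= tau * (amax a - tau) by rewrite mulr_ge0// subr_ge0 ltW.
  by lra.
rewrite (adm_large lam_gt0 delta large); split.
  case=> _ [//|[yd|Md|le_lam]]; exfalso.
  - by move: (lt_le_trans ty yd); rewrite ltNge dt.
  - by move: (lt_le_trans tM Md); rewrite ltNge dt.
  have : 0 <= (amax a - tau) * (tau - delta) by rewrite mulr_ge0// subr_ge0// ltW.
  have : 0 <= (tau - delta) * (`|y| - delta).
    by rewrite mulr_ge0// subr_ge0// (le_trans dt)// ltW.
  by lra.
by move=> h; split=> //; left.
Qed.

(** In this range the infimum is half the gap and is attained. So [stsp < t] is the failure of a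
    nonstrict gap inequality, while [stsp <= r] will be the failure of a strict one. *)
Lemma stsp_lt_robust y a tau t : (1 < N)%N -> robust y a tau -> 0 < t <= tau ->
  (stsp lam (const_mx y) a < t%:E)%E <->
  ~ exists j, amax_but a j + 2 * t <= `|a 0 j|.
Proof.
move=> N1 rob /andP[t0 tt]; split.
  move=> /stsp_ltP[delta ad dt] [j jt].
  have d0 : 0 <= delta by case: ad.
  move: ad => /(adm_robust rob); rewrite d0 (le_trans (ltW dt))// => /(_ isT).
  by move=> /(near_tieP _ N1 d0); apply; exists j; lra.
move=> nj; have [j jM] := amax_arg a (ltnW N1).
have [i ij iY] := amax_but_arg a j N1.
have YM := amax_but_le_amax a j.
have lt2t : `|a 0 j| < amax_but a j + 2 * t.
  by rewrite ltNge; apply/negP => h; apply: nj; exists j.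
pose delta := (amax a - amax_but a j) / 2.
have dt : delta < t by rewrite /delta; lra.
have d0 : 0 <= delta by rewrite /delta; lra.
apply: (@le_lt_trans _ _ delta%:E); last by rewrite lte_fin.
apply: stsp_le; apply/(adm_robust rob); first by rewrite d0; lra.
by exists i, j; split => //; rewrite iY /delta; lra.
Qed.

Lemma stsp_le_robust y a tau r : (1 < N)%N -> robust y a tau -> 0 <= r < tau ->
  (stsp lam (const_mx y) a <= r%:E)%E <->
  ~ exists j, amax_but a j + 2 * r < `|a 0 j|.
Proof.
move=> N1 rob /andP[r0 rt]; split; last first.
  move=> nj; apply: stsp_le; apply/(adm_robust rob); first by rewrite r0 ltW.
  exact/near_tieP.
(* A level above [r] that exceeds neither [tau] nor half the gap at [j]: the strict version at [t]
   already contradicts the gap. *)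
move=> sr [j jr]; pose t := Num.min tau ((`|a 0 j| - amax_but a j) / 2).
have rt' : r < t by rewrite /t lt_min rt/=; lra.
have : (stsp lam (const_mx y) a < t%:E)%E by rewrite (le_lt_trans sr)// lte_fin.
move=> /(stsp_lt_robust N1 rob); rewrite (le_lt_trans r0 rt') ge_min lexx.
move=> /(_ isT); apply; exists j.
have : t <= (`|a 0 j| - amax_but a j) / 2 by rewrite /t ge_min lexx orbT.
by lra.
Qed.

(** When [|y| <= t], the border between the two regimes is within reach from either side. If 0 is
    the only minimiser, enlarging everything by [t / 2] suffices; otherwise it is enough to go below
    [|y|] by the amount that brings it to [lam / (2 * amax a)], which is less than [t]. *)
Lemma stsp_lt_amax y a t : (0 < N)%N -> 0 < t -> `|y| <= t ->
  lam / t < amax a -> (stsp lam (const_mx y) a < t%:E)%E.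
Proof.
move=> N0 t0 yt; rewrite ltr_pdivrMr// => aM.
suff [delta ad dt] : exists2 delta, adm lam y a delta & delta < t.
  by apply: le_lt_trans (stsp_le ad) _; rewrite lte_fin.
have y0 := normr_ge0 y; have a0 := amax_ge0 a.
have [small|large] := leP (2 * amax a * `|y|) lam.
  (* [2 (amax a + t / 2) (|y| + t / 2) >= amax a * t > lam]. *)
  exists (t / 2); last by lra.
  apply/(adm_small lam_gt0 N0 _ small); split; first by lra.
  by nra.
have aM0 : 0 < amax a.
  rewrite lt_neqAle a0 andbT eq_sym; apply/eqP => aM0.
  by move: large; rewrite aM0 mulr0 mul0r ltNge (ltW lam_gt0).
have yE : 2 * amax a * (lam / (2 * amax a)) = lam.
  by rewrite mulrC divfK// mulf_neq0// gt_eqF.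
have q0 : 0 < lam / (2 * amax a) by rewrite divr_gt0// mulr_gt0.
have qy : lam / (2 * amax a) < `|y| by rewrite ltr_pdivrMr ?mulr_gt0//; lra.
exists (`|y| - lam / (2 * amax a)); last by lra.
apply/(adm_large lam_gt0 _ large); split; first by lra.
right; apply: Or33.
set q := lam / _ in yE q0 qy *.
have : 0 <= (`|y| - q) * q by rewrite mulr_ge0 ?subr_ge0 ?(ltW qy) ?(ltW q0).
by lra.
Qed.

End condition_number.

(** * The gap between the two largest entries of an i.i.d. row *)

(** Open rays are stable under intersection and generate the Borel sets. They are also the events
    for which the independence of [other_max] is established below. *)
Lemma measure_eq_itvNyo (R : realType) (m1 m2 : {measure set R -> \bar R}) :
  (m1 setT < +oo)%E -> (forall c : R, m1 `]-oo, c[%classic = m2 `]-oo, c[%classic) ->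
  forall A, measurable A -> m1 A = m2 A.
Proof.
move=> m1oo m12 A mA.
apply: (measure_unique (@RGenInftyO.G R) (fun n => `]-oo, n%:R[%classic)) => //.
- exact: RGenInftyO.measurableE.
- move=> _ _ [x ->] [y ->]; exists (Num.min x y).
  by apply/seteqP; split => z /=; rewrite !in_itv/= lt_min => /andP.
- by move=> i; exists i%:R.
- apply/seteqP; split=> // x _.
  exists (Num.trunc `|x|).+1 => //=; rewrite in_itv/=.
  by rewrite (le_lt_trans (ler_norm x))// truncnS_gt.
- by move=> _ [c ->].
- by move=> k; apply: le_lt_trans m1oo; apply: le_measure; rewrite ?inE.
Qed.

Section pair_law.
Context d (T : measurableType d) (R : realType) (P : probability T R).
Variables X Y : {RV P >-> R}.
Hypothesis indepYX : forall (c : R) B, measurable B ->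
  P (Y @^-1` `]-oo, c[%classic `&` X @^-1` B) =
  (P (Y @^-1` `]-oo, c[%classic) * P (X @^-1` B))%E.

(** For fixed [B] both sides are finite measures in [C], so agreement on rays suffices. *)
Let indepYX_borel C B : measurable C -> measurable B ->
  P (Y @^-1` C `&` X @^-1` B) = (P (Y @^-1` C) * P (X @^-1` B))%E.
Proof.
move=> mC mB.
have mXB : measurable (X @^-1` B) by exact: measurable_funPTI.
pose m1 := pushforward (mrestr P mXB) Y.
have PX0 : 0 <= fine (P (X @^-1` B)) by rewrite fine_ge0.
pose m2 := mscale (NngNum PX0) (distribution P Y).
have PXE : (fine (P (X @^-1` B)))%:E = P (X @^-1` B).
  by rewrite fineK// fin_num_measure.
have -> : P (Y @^-1` C `&` X @^-1` B) = m1 C by [].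
have -> : (P (Y @^-1` C) * P (X @^-1` B) = m2 C)%E.
  by rewrite /m2 /mscale/= PXE muleC.
apply: measure_eq_itvNyo => //.
  apply: (@le_lt_trans _ _ 1%E); last by rewrite ltry.
  have mYX : measurable (Y @^-1` setT `&` X @^-1` B) by rewrite preimage_setT setTI.
  exact: (probability_le1 P mYX).
move=> c; rewrite /= /pushforward /mrestr /mscale/= PXE muleC.
exact: indepYX.
Qed.

Lemma pair_lawE E : measurable E ->
  P ((fun w => (Y w, X w)) @^-1` E) =
  (\int[distribution P Y]_y distribution P X (xsection E y))%E.
Proof.
move=> mE.
have mYX : measurable_fun setT (fun w => (Y w, X w)).
  exact: measurable_fun_pair.
have := @product_measure_unique _ _ _ _ _ (distribution P Y) (distribution P X)
  (pushforward P (fun w => (Y w, X w))).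
move=> /(_ mYX) uniq_prod; have := uniq_prod _ E mE.
by rewrite /product_measure1 => -> // A B mA mB; exact: indepYX_borel.
Qed.

(** By independence both probabilities are integrals of section masses against the law of [Y], so a
    bound at each level of [Y] integrates to a bound on the probabilities. *)
Lemma pair_law_le E E' (q : R) : measurable E -> measurable E' -> 0 <= q ->
  (forall y, (distribution P X (xsection E y) <=
              q%:E * distribution P X (xsection E' y))%E) ->
  (P ((fun w => (Y w, X w)) @^-1` E) <=
   q%:E * P ((fun w => (Y w, X w)) @^-1` E'))%E.
Proof.
move=> mE mE' q0 le_q; rewrite !pair_lawE// -ge0_integralZl//.
- apply: ge0_le_integral => //.
  + exact: measurable_fun_xsection.
  + by apply: measurable_funeM; exact: measurable_fun_xsection.
- exact: measurable_fun_xsection.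
Qed.

End pair_law.

Lemma measurable_bigmax d (T : measurableType d) (R : realType) (I : Type)
    (s : seq I) (p : pred I) (x0 : R) (f : I -> T -> R) :
  (forall i, measurable_fun setT (f i)) ->
  measurable_fun setT (fun w => \big[Num.max/x0]_(i <- s | p i) f i w).
Proof.
move=> mf; elim: s => [|i s IH].
  by under eq_fun do rewrite big_nil; exact: measurable_cst.
under eq_fun do rewrite big_cons; case: (p i) => //.
exact: measurable_maxr.
Qed.

Section iid_row.
Context d (T : measurableType d) (R : realType) (P : probability T R) (N : nat).
Variable X : 'I_N -> {RV P >-> R}.
Variable mu : set R -> \bar R.
Hypothesis iidX : iid_with_law X mu.

Let lawX i B : measurable B -> P (X i @^-1` B) = mu B.
Proof. exact: iidX.2. Qed.

Definition other_max (j : 'I_N) (w : T) : R := amax_but (random_row X w) j.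

Lemma other_maxE j w :
  other_max j w = \big[Num.max/0]_(i | i != j) `|X i w|.
Proof. by apply: eq_bigr => i _; rewrite mxE. Qed.

Lemma measurable_other_max j : measurable_fun setT (other_max j).
Proof.
rewrite (_ : other_max j = fun w => \big[Num.max/0]_(i | i != j) `|X i w|).
  by apply: measurable_bigmax => i; exact: measurableT_comp.
by apply/funext => w; rewrite other_maxE.
Qed.

HB.instance Definition _ j :=
  isMeasurableFun.Build _ _ _ _ (other_max j) (measurable_other_max j).

Lemma measurable_amax : measurable_fun setT (fun w => amax (random_row X w)).
Proof.
rewrite (_ : (fun _ => _) = fun w => \big[Num.max/0]_i `|X i w|).
  by apply: measurable_bigmax => i; exact: measurableT_comp.
by apply/funext => w; apply: eq_bigr => i _; rewrite mxE.
Qed.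

Lemma prob_amax_le (c p : R) : 0 <= c -> mu [set x | `|x| <= c] = p%:E ->
  P [set w | amax (random_row X w) <= c] = (p ^+ N)%:E.
Proof.
move=> c0 Bp; pose B := [set x : R | `|x| <= c].
have mB : measurable B.
  rewrite (_ : B = `[- c, c]%classic)//.
  by rewrite /B; apply/seteqP; split => x /=; rewrite in_itv/= ler_norml.
have := iidX.1 [set: 'I_N]%SET (fun=> B) (fun=> mB).
rewrite (eq_bigr (fun=> p%:E)); last by move=> i _; rewrite lawX.
rewrite prodEFin prodr_const finset.cardsT card_ord => <-; congr (P _).
apply/seteqP; split => w /=.
  by move=> /bigmax_leP[_ h] i _; have := h i isT; rewrite mxE.
move=> h; apply/bigmax_leP; split=> // i _; rewrite mxE.
by apply: h; rewrite /= finset.in_setT.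
Qed.

(** For [c > 0] the event on [other_max] is the intersection of [|X_i| < c] over [i != j], so both
    sides come from the product formula of mutual independence; for [c <= 0] the event is empty. *)
Lemma other_max_indep j (c : R) B : measurable B ->
  P (other_max j @^-1` `]-oo, c[ `&` X j @^-1` B) =
  (P (other_max j @^-1` `]-oo, c[) * P (X j @^-1` B))%E.
Proof.
move=> mB; have [c0|c0] := leP c 0.
  have -> : other_max j @^-1` `]-oo, c[%classic = set0.
    apply/seteqP; split => w //=; rewrite in_itv/= => h.
    by have := lt_le_trans h c0; rewrite ltNge amax_but_ge0.
  by rewrite set0I measure0 mul0e.
pose D := [set x : R | `|x| < c].
have mD : measurable D.
  rewrite (_ : D = `]- c, c[%classic)//.
  by rewrite /D; apply/seteqP; split => x /=; rewrite in_itv/= ltr_norml.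
have YE : other_max j @^-1` `]-oo, c[%classic =
    \bigcap_(i in [set` [set~ j]%SET]) (X i @^-1` D).
  apply/seteqP; split => w /=; rewrite in_itv/= other_maxE.
    move=> /bigmax_ltP[_ h] i /=; rewrite in_setC1 => ij; exact: h.
  move=> h; apply/bigmax_ltP; split => // i ij.
  by apply: h; rewrite /= in_setC1.
have := iidX.1 [set~ j]%SET (fun=> D) (fun=> mD).
rewrite -YE => ->.
pose F i := if i == j then B else D.
have mF i : measurable (F i) by rewrite /F; case: ifP.
have := iidX.1 [set: 'I_N]%SET F mF.
have Fj : F j = B by rewrite /F eqxx.
rewrite (bigD1 j) ?finset.in_setT//= Fj muleC => YX.
rewrite (_ : _ `&` _ = \bigcap_(i in [set` [set: 'I_N]%SET]) X i @^-1` F i).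
  rewrite YX; congr (_ * _)%E.
  apply: eq_big => [i|i]; first by rewrite finset.in_setC1 finset.in_setT.
  by rewrite finset.in_setT/= /F => /negbTE ->.
rewrite YE; apply/seteqP; split => w /=.
  move=> [h Bj] i _; rewrite /F; case: eqVneq => [->//|ij].
  by apply: h; rewrite /= finset.in_setC1.
move=> h; split; last by have := h j; rewrite /F eqxx; apply; rewrite /= finset.in_setT.
move=> i; rewrite /= finset.in_setC1 => ij.
by have := h i; rewrite /F (negbTE ij); apply; rewrite /= finset.in_setT.
Qed.

End iid_row.

Section finite_unions.
Context d (T : measurableType d) (R : realType) (P : probability T R).
Variables (n : nat) (F : 'I_n -> set T).
Hypothesis mF : forall i, measurable (F i).

Let existsE : [set w | exists i, F i w] = \bigcup_(i in [set: 'I_n]) F i.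
Proof. by apply/seteqP; split => w [i]; exists i. Qed.

Lemma measurable_exists : measurable [set w | exists i, F i w].
Proof. by rewrite existsE; exact: fin_bigcup_measurable. Qed.

Lemma prob_exists_le : (P [set w | exists i, F i w] <= \sum_i P (F i))%E.
Proof.
have [s sE] : exists s, s = index_enum 'I_n by exists (index_enum 'I_n).
have -> : [set w | exists i, F i w] = [set w | exists2 i, i \in s & F i w].
  apply/seteqP; split => w [i].
    by exists i => //; rewrite sE mem_index_enum.
  by move=> _ Fi; exists i.
rewrite -sE => {sE}; elim: s => [|j s IH].
  rewrite big_nil (_ : [set _ | _] = set0) ?measure0//.
  by apply/seteqP; split => w // [].
have mFs : measurable [set w | exists2 i, i \in s & F i w].
  have -> : [set w | exists2 i, i \in s & F i w] = \bigcup_(i in [set` s]) F i by [].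
  exact: fin_bigcup_measurable.
rewrite big_cons; apply: (le_trans _ (leeD2l (P (F j)) IH)).
rewrite (_ : [set _ | _] = F j `|` [set w | exists2 i, i \in s & F i w]).
  exact: measureU2.
apply/seteqP; split => w /=.
  by move=> [i]; rewrite in_cons => /orP[/eqP ->|]; [left|right; exists i].
by move=> [Fj|[i si Fi]]; [exists j; rewrite ?mem_head|exists i; rewrite // in_cons si orbT].
Qed.

Lemma prob_exists_trivIset : trivIset setT F ->
  P [set w | exists i, F i w] = (\sum_i P (F i))%E.
Proof.
move=> tF; rewrite -(measure_bigsetU_ord P xpredT mF tF) -bigcup_seq.
congr (P _); apply/seteqP; split => w [i].
  by exists i => //=; rewrite mem_index_enum.
by move=> _ Fi; exists i.
Qed.

End finite_unions.

Section row_events.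
Context d (T : measurableType d) (R : realType) (P : probability T R) (N : nat).
Variable X : 'I_N -> {RV P >-> R}.
Variable mu : set R -> \bar R.
Hypothesis iidX : iid_with_law X mu.

Implicit Types E : set (R * R).

Definition row_event E : set T := [set w | exists j, E (other_max X j w, X j w)].

Definition above : set (R * R) := [set p | p.1 < `|p.2|].

Let mYX j E : measurable E -> measurable ((fun w => (other_max X j w, X j w)) @^-1` E).
Proof.
move=> mE; have mYX : measurable_fun setT (fun w => (other_max X j w, X j w)).
  by apply: measurable_fun_pair => //; exact: measurable_other_max.
by rewrite -[X in measurable X]setTI; exact: mYX.
Qed.

Lemma measurable_row_event E : measurable E -> measurable (row_event E).
Proof. by move=> mE; apply: measurable_exists => j; exact: mYX. Qed.

(** Inside [above] the events for two distinct indices are disjoint, since each of the two moduli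
    would strictly exceed the other. *)
Lemma prob_row_event E : measurable E -> E `<=` above ->
  P (row_event E) =
  (\sum_j P ((fun w => (other_max X j w, X j w)) @^-1` E))%E.
Proof.
move=> mE Ea; apply: prob_exists_trivIset => [j|]; first exact: mYX.
apply/trivIsetP => i j _ _ ij; apply/seteqP; split => // w [/Ea + /Ea].
rewrite /above/= => hi hj.
have := @le_amax_but _ _ (random_row X w) _ _ ij.
have := @le_amax_but _ _ (random_row X w) j i; rewrite eq_sym ij => /(_ isT).
rewrite !mxE -/(other_max X i w) -/(other_max X j w) => h1 h2.
by have := lt_le_trans (lt_trans (lt_le_trans hi h2) hj) h1; rewrite ltxx.
Qed.

Let pair_le j E E' (q : R) : measurable E -> measurable E' -> 0 <= q ->
  (forall y, 0 <= y ->
    (mu [set x | E (y, x)] <= q%:E * mu [set x | E' (y, x)])%E) ->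
  (P ((fun w => (other_max X j w, X j w)) @^-1` E) <=
   q%:E * P ((fun w => (other_max X j w, X j w)) @^-1` E'))%E.
Proof.
(* [other_max] is nonnegative, so intersecting with [D] changes no event, and the comparison of
   section masses is then required at nonnegative levels only. *)
move=> mE mE' q0 le_q; pose D : set (R * R) := [set p | 0 <= p.1].
have mD : measurable D.
  have -> : D = fst @^-1` `[0, +oo[%classic.
    by apply/seteqP; split => p; rewrite /D/= in_itv/= andbT.
  rewrite -[X in measurable X]setTI; exact: measurable_fst.
have restrD F : (fun w => (other_max X j w, X j w)) @^-1` F =
    (fun w => (other_max X j w, X j w)) @^-1` (F `&` D).
  apply/seteqP; split => w /=; last by case.
  by move=> Fw; split => //; exact: (amax_but_ge0 (random_row X w) j).
rewrite restrD [in leRHS]restrD.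
apply: (pair_law_le (Y := other_max X j)) => //.
- exact: (other_max_indep iidX).
- exact: measurableI.
- exact: measurableI.
move=> y.
have secD F : xsection (F `&` D) y = if 0 <= y then [set x | F (y, x)] else set0.
  apply/seteqP; split => x; rewrite /xsection/= inE.
    by move=> [Fx]; rewrite /D/= => ->.
  by case: ifP.
have distE F : measurable F ->
    distribution P (X j) (xsection (F `&` D) y) =
    if 0 <= y then mu [set x | F (y, x)] else 0%E.
  move=> mF; have := @measurable_xsection _ _ _ _ _ y (measurableI _ _ mF mD).
  rewrite !secD; case: ifP => _ mFy; last by rewrite measure0.
  exact: iidX.2.
by rewrite !distE//; case: ifP => [/le_q//|_]; rewrite mule0.
Qed.

(* The events (Y_j, X_j) \in E are disjoint for distinct j, and the law of
   (Y_j, X_j) is a product: condition on Y_j, for each j. *)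
Lemma prob_row_event_le E E' (q : R) : measurable E -> measurable E' -> 0 <= q ->
  E `<=` above -> E' `<=` above ->
  (forall y, 0 <= y ->
    (mu [set x | E (y, x)] <= q%:E * mu [set x | E' (y, x)])%E) ->
  (P (row_event E) <= q%:E * P (row_event E'))%E.
Proof.
move=> mE mE' q0 Ea Ea' le_q; rewrite !prob_row_event//.
rewrite ge0_sume_distrr//; apply: lee_sum => j _; exact: pair_le.
Qed.

Lemma measurable_above : measurable above.
Proof.
rewrite -[above]setTI.
have : measurable_fun setT (fun p : R * R => p.1 < `|p.2|).
  by apply: measurable_fun_ltr => //; exact: measurableT_comp.
by move=> /(_ measurableT [set true]); apply.
Qed.

(** If no entry strictly beats the others, some pair satisfies [|X_j| = Y_j]. As [Y_j] is
    independent of [X_j] and the modulus has no atom, this has probability 0. *)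
Lemma prob_unique_max : (0 < N)%N ->
  (forall y, 0 <= y -> mu [set x | `|x| = y] = 0%E) ->
  P (row_event above) = 1%E.
Proof.
move=> N0 atom0.
pose E : set (R * R) := [set p | `|p.2| = p.1].
have mE : measurable E.
  rewrite -[E]setTI.
  have : measurable_fun setT (fun p : R * R => `|p.2| == p.1).
    by apply: measurable_fun_eqr => //; exact: measurableT_comp.
  move=> /(_ measurableT [set true]); rewrite (_ : _ @^-1` _ = E); first exact.
  by apply/seteqP; split => p /= /eqP.
have tie0 : P (row_event E) = 0%E.
  apply/eqP; rewrite eq_le measure_ge0 andbT.
  apply: (le_trans (prob_exists_le P (fun j => mYX j mE))).
  apply: sume_le0 => j _.
  (* The comparison with factor 0 says that a set whose sections are null has probability 0. *)
  apply: (le_trans (pair_le j mE mE (lexx 0) _)); last by rewrite mul0e.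
  by move=> y y0; rewrite mul0e atom0.
have cover : ~` row_event above `<=` row_event E.
  move=> w nw; have [j jM] := amax_arg (random_row X w) N0.
  exists j; apply/eqP; rewrite /E/= eq_le; apply/andP; split.
    by rewrite leNgt; apply/negP => h; apply: nw; exists j.
  by rewrite (le_trans (amax_but_le_amax _ _))// -jM mxE.
have ma := measurable_row_event measurable_above.
have a0 : P (~` row_event above) = 0%E.
  apply/eqP; rewrite eq_le measure_ge0 andbT -tie0.
  apply: le_measure; rewrite ?inE//; first exact: measurableC.
  exact: measurable_row_event.
by have := probability_setC P (measurableC ma); rewrite setCK a0 sube0.
Qed.

End row_events.

Lemma measurable_bool_set d (T : measurableType d) (b : T -> bool) :
  measurable_fun setT b -> measurable [set w | b w].
Proof.
by move=> mb; rewrite -[X in measurable X]setTI; exact: (mb measurableT [set true]).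
Qed.

(** * Measurability of the events on the stability support *)

Section measurable_stsp.
Context d (T : measurableType d) (R : realType) (P : probability T R) (N : nat).
Variable X : 'I_N -> {RV P >-> R}.
Variables (lam y : R).
Hypothesis lam_gt0 : 0 < lam.
Hypothesis N_gt1 : (1 < N)%N.

Definition gap_event (s : R) : set T := row_event X [set p | p.1 + s < `|p.2|].

Definition gap_event_closed (s : R) : set T :=
  row_event X [set p | p.1 + s <= `|p.2|].

Lemma measurable_gap_set (s : R) :
  measurable [set p : R * R | p.1 + s < `|p.2|].
Proof.
apply: measurable_bool_set; apply: measurable_fun_ltr.
  by apply: measurable_funD => //; exact: measurable_cst.
exact: measurableT_comp.
Qed.

Lemma measurable_gap_set_closed (s : R) :
  measurable [set p : R * R | p.1 + s <= `|p.2|].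
Proof.
apply: measurable_bool_set; apply: measurable_fun_ler.
  by apply: measurable_funD => //; exact: measurable_cst.
exact: measurableT_comp.
Qed.

Lemma measurable_gap_event s : measurable (gap_event s).
Proof. by apply: measurable_row_event; exact: measurable_gap_set. Qed.

Lemma measurable_gap_event_closed s : measurable (gap_event_closed s).
Proof. by apply: measurable_row_event; exact: measurable_gap_set_closed. Qed.

Lemma gap_eventE s w : gap_event s w <->
  exists j, amax_but (random_row X w) j + s < `|random_row X w 0 j|.
Proof. by split=> -[j]; [move=> h; exists j; rewrite mxE|rewrite mxE => h; exists j]. Qed.

Lemma gap_event_closedE s w : gap_event_closed s w <->
  exists j, amax_but (random_row X w) j + s <= `|random_row X w 0 j|.
Proof. by split=> -[j]; [move=> h; exists j; rewrite mxE|rewrite mxE => h; exists j]. Qed.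

Let measurable_amax_fun (f : R -> R) (c : R) : measurable_fun setT f ->
  measurable [set w | f (amax (random_row X w)) <= c].
Proof.
move=> mf; apply: measurable_bool_set; apply: measurable_fun_ler => //.
by apply: measurableT_comp => //; exact: measurable_amax.
Qed.

(* [P] is unconstrained on sets that are not measurable, so the events of the
   theorem have to be shown measurable, not only approximated. *)
Lemma measurable_adm delta :
  measurable [set w | adm lam y (random_row X w) delta].
Proof.
have [d0|d0] := leP 0 delta; last first.
  rewrite (_ : [set _ | _] = set0)//; apply/seteqP; split => w //= -[].
  by rewrite leNgt d0.
pose M w := amax (random_row X w).
pose S1 := [set w | 2 * M w * `|y| <= lam].
pose S2 := [set w | 2 * (M w + delta) * (`|y| + delta) <= lam].
pose S3 := [set w | M w <= delta].
pose S4 := [set w | 2 * (M w - delta) * (`|y| - delta) <= lam].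
have mS1 : measurable S1.
  apply: (@measurable_amax_fun (fun m => 2 * m * `|y|)).
  by do 2?apply: measurable_funM => //.
have mS2 : measurable S2.
  apply: (@measurable_amax_fun (fun m => 2 * (m + delta) * (`|y| + delta))).
  apply: measurable_funM => //; apply: measurable_funM => //.
  exact: measurable_funD.
have mS3 : measurable S3 by apply: (@measurable_amax_fun id).
have mS4 : measurable S4.
  apply: (@measurable_amax_fun (fun m => 2 * (m - delta) * (`|y| - delta))).
  apply: measurable_funM => //; apply: measurable_funM => //.
  exact: measurable_funB.
pose S5 : set T := [set w | `|y| <= delta].
have mS5 : measurable S5.
  by apply: measurable_bool_set; exact: measurable_cst.
rewrite (_ : [set _ | _] = (S1 `&` ~` S2) `|`
    (~` S1 `&` (~` gap_event (2 * delta) `|` (S5 `|` (S3 `|` S4))))).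
  have mG := measurable_gap_event (2 * delta).
  apply: measurableU; apply: measurableI; [exact: mS1|exact: measurableC|exact: measurableC|].
  by apply: measurableU; [exact: measurableC|do 2?apply: measurableU].
apply/seteqP; split => w /=.
  have [small|large] := leP (2 * M w * `|y|) lam.
    move=> /(adm_small lam_gt0 (ltnW N_gt1) _ small)[_ h]; left.
    by split => //; apply/negP; rewrite -ltNge.
  move=> /(adm_large lam_gt0 _ large)[_ h]; right.
  split; first by apply/negP; rewrite -ltNge.
  case: h => [/(near_tieP _ N_gt1 d0) h|[h|h|h]].
  - by left=> /gap_eventE.
  - by right; left.
  - by right; right; left.
  - by right; right; right.
move=> [[small nS2]|[/negP + h]].
  apply/(adm_small lam_gt0 (ltnW N_gt1) _ small); split => //.
  by move/negP : nS2; rewrite -ltNge.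
rewrite -ltNge => large; apply/(adm_large lam_gt0 _ large); split => //.
case: h => [h|[h|[h|h]]].
- by left; apply/near_tieP => // /gap_eventE.
- by right; apply: Or31.
- by right; apply: Or32.
- by right; apply: Or33.
Qed.

(** [adm] is upward closed in [delta], so [stsp < t] means that [t - 1 / (n + 1)] is admissible for
    some [n]: a countable union. *)
Lemma measurable_stsp_lt t : measurable
  [set w | (stsp lam (const_mx y) (random_row X w) < t%:E)%E].
Proof.
rewrite (_ : [set _ | _] =
    \bigcup_n [set w | adm lam y (random_row X w) (t - n.+1%:R^-1)]).
  by apply: bigcupT_measurable => n; exact: measurable_adm.
apply/seteqP; split => w /=.
  move=> /stsp_ltP[delta [d0 [y' [a' [x [x' [? ? yy aa ?]]]]]] dt].
  have [n nt] := ltr_add_invr dt.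
  have dn : delta <= t - n.+1%:R^-1 by rewrite lerBrDr ltW.
  exists n => //; split; first exact: le_trans dn.
  by exists y', a', x, x'; split => //; apply: le_trans dn.
move=> [n _ /stsp_le /le_lt_trans]; apply.
by rewrite lte_fin ltrBlDr ltrDl invr_gt0.
Qed.

Lemma measurable_stsp_le r : measurable
  [set w | (stsp lam (const_mx y) (random_row X w) <= r%:E)%E].
Proof.
rewrite (_ : [set _ | _] = \bigcap_n
    [set w | (stsp lam (const_mx y) (random_row X w) < (r + n.+1%:R^-1)%:E)%E]).
  by apply: bigcapT_measurable => n; exact: measurable_stsp_lt.
apply/seteqP; split => w /=.
  by move=> h n _ /=; rewrite (le_lt_trans h)// lte_fin ltrDl invr_gt0.
move=> h; apply/lee_addgt0Pr => e e0.
have [n ne] := ltr_add_invr e0; rewrite add0r in ne.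
by apply: ltW; apply: lt_trans (h n I) _; rewrite -EFinD lte_fin ltrD2l.
Qed.

End measurable_stsp.

(** * From tail comparisons to the probability of a gap *)

Section gap_bounds.
Context d (T : measurableType d) (R : realType) (P : probability T R) (N : nat).
Variable X : 'I_N -> {RV P >-> R}.
Variable mu : set R -> \bar R.
Hypothesis iidX : iid_with_law X mu.
Hypothesis N_gt0 : (0 < N)%N.
Variable F : R -> R.
Hypothesis muF : forall c, 0 <= c -> mu [set x | `|x| <= c] = (F c)%:E.
Hypothesis mu_atom : forall c, 0 <= c -> mu [set x | `|x| = c] = 0%E.

Let nu : probability _ _ := distribution P (X (Ordinal N_gt0)).

Let nuE B : measurable B -> mu B = nu B.
Proof. by move=> mB; rewrite -(iidX.2 (Ordinal N_gt0)). Qed.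

Let measurable_abs_le (c : R) : measurable [set x : R | `|x| <= c].
Proof. by apply: measurable_bool_set; exact: measurable_fun_ler. Qed.

Let measurable_abs_lt (c : R) : measurable [set x : R | c < `|x|].
Proof. by apply: measurable_bool_set; exact: measurable_fun_ltr. Qed.

Lemma mu_abs_gt c : 0 <= c -> mu [set x | c < `|x|] = (1 - F c)%:E.
Proof.
move=> c0; have := probability_setC nu (measurable_abs_le c).
rewrite -!nuE//; last exact: measurableC.
rewrite muF// EFinB => <-; congr mu; apply/seteqP; split => x /=.
  by move=> h; apply/negP; rewrite -ltNge.
by move=> /negP; rewrite -ltNge.
Qed.

Lemma mu_abs_ge c : 0 <= c -> mu [set x | c <= `|x|] = (1 - F c)%:E.
Proof.
move=> c0; rewrite -mu_abs_gt//.
have meq : measurable [set x : R | `|x| = c].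
  have -> : [set x : R | `|x| = c] = [set x | `|x| == c].
    by apply/seteqP; split => x /= /eqP.
  by apply: measurable_bool_set; exact: measurable_fun_eqr.
have mge : measurable [set x : R | c <= `|x|].
  by apply: measurable_bool_set; exact: measurable_fun_ler.
rewrite !nuE// (_ : [set x | c <= `|x|] = [set x | c < `|x|] `|` [set x | `|x| = c]).
  rewrite measureU//.
    rewrite [X in (_ + X)%E](_ : _ = 0%E) ?adde0//.
    by have := mu_atom c0; rewrite nuE.
  by apply/seteqP; split => x //= [] + xc; rewrite xc ltxx.
apply/seteqP; split => x /=; first by rewrite le_eqVlt => /orP[/eqP ->|]; [right|left].
by move=> [/ltW//|->].
Qed.

Lemma mu_abs_itv c e : 0 <= c -> c <= e ->
  mu [set x | c < `|x| <= e] = (F e - F c)%:E.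
Proof.
move=> c0 ce; have e0 := le_trans c0 ce.
pose A := [set x : R | `|x| <= c]; pose B := [set x : R | c < `|x| <= e].
have mB : measurable B.
  apply: measurable_bool_set; apply: measurable_and.
    exact: measurable_fun_ltr.
  exact: measurable_fun_ler.
have : nu [set x | `|x| <= e] = (nu A + nu B)%E.
  rewrite -measureU//; last 2 first.
  - exact: measurable_abs_le.
  - by apply/seteqP; split => x //= [xc /andP[]]; rewrite ltNge xc.
  congr (nu _); apply/seteqP; split => x /=.
    by move=> xe; case: (leP `|x| c) => xc; [left|right; rewrite /B/= xc].
  by move=> [xc|/andP[]//]; exact: le_trans ce.
have -> : nu A = (F c)%:E by rewrite -nuE ?muF//; exact: measurable_abs_le.
rewrite -!nuE// muF//.
case: (mu B) => [v| |]//; rewrite -?EFinD.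
by move=> [->]; rewrite addrC addKr.
Qed.

Lemma muF_itv c : 0 <= c -> 0 <= F c <= 1.
Proof.
move=> c0; rewrite -!lee_fin -muF// nuE// measure_ge0/=.
exact: probability_le1.
Qed.

(** At a fixed level of [Y_j] the two events differ by an atom of the modulus, which is null, so the
    comparison with factor 1 applies both ways. *)
Lemma prob_gap_event_closed s : 0 < s -> P (gap_event_closed X s) = P (gap_event X s).
Proof.
move=> s0.
have Ea : [set p : R * R | p.1 + s < `|p.2|] `<=` @above R.
  by move=> p /=; apply: lt_trans; rewrite ltrDl.
have Eca : [set p : R * R | p.1 + s <= `|p.2|] `<=` @above R.
  by move=> p /=; apply: lt_le_trans; rewrite ltrDl.
have mE := measurable_gap_set s; have mEc := measurable_gap_set_closed s.
apply/eqP; rewrite eq_le; apply/andP; split.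
  rewrite -[leRHS]mul1e; apply: (prob_row_event_le iidX) => // y y0.
  by rewrite mul1e /= mu_abs_ge ?mu_abs_gt// addr_ge0// ltW.
rewrite -[leRHS]mul1e; apply: (prob_row_event_le iidX) => // y y0.
by rewrite mul1e /= mu_abs_ge ?mu_abs_gt// addr_ge0// ltW.
Qed.

Let measurable_and_le (U : R) (b : R * R -> bool) : measurable_fun setT b ->
  measurable [set p : R * R | b p && (`|p.2| <= U)].
Proof.
move=> mb; apply: measurable_bool_set; apply: measurable_and => //.
by apply: measurable_fun_ler => //; exact: measurableT_comp.
Qed.

Let gap_above s : 0 <= s -> [set p : R * R | p.1 + s < `|p.2|] `<=` @above R.
Proof. by move=> s0 p /=; apply: le_lt_trans; rewrite lerDl. Qed.

Let measurable_above_le U : measurable [set p : R * R | (p.1 < `|p.2|) && (`|p.2| <= U)].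
Proof.
apply: measurable_and_le; apply: measurable_fun_ltr => //.
exact: measurableT_comp.
Qed.

Let above_le_sub U : [set p : R * R | (p.1 < `|p.2|) && (`|p.2| <= U)] `<=` @above R.
Proof. by move=> p /= /andP[]. Qed.

(** Up to ties this row event is [amax <= U]. It turns [F U ^ N] into the probability of a row
    event, with which gap events can be compared level by level. *)
Lemma prob_above_le U : 0 <= U ->
  P (row_event X [set p | (p.1 < `|p.2|) && (`|p.2| <= U)]) = (F U ^+ N)%:E.
Proof.
move=> U0; rewrite -(prob_amax_le iidX U0 (muF U0)).
have mA : measurable [set w | amax (random_row X w) <= U].
  by apply: measurable_bool_set; apply: measurable_fun_ler => //; exact: measurable_amax.
have ma : measurable (row_event X (@above R)).
  by apply: measurable_row_event; exact: measurable_above.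
have rowE : row_event X [set p | (p.1 < `|p.2|) && (`|p.2| <= U)] =
    [set w | amax (random_row X w) <= U] `&` row_event X (@above R).
  apply/seteqP; split => w /=.
    move=> [j /andP[jY jU]]; split; last by exists j.
    apply: amax_le => // i; have [->|ij] := eqVneq i j; first by rewrite mxE.
    by rewrite (le_trans (le_amax_but _ ij))// (le_trans (ltW jY)).
  move=> [aU [j jY]]; exists j; apply/andP; split => //.
  by apply: le_trans aU; have := le_amax (random_row X w) j; rewrite mxE.
rewrite rowE; apply/eqP; rewrite eq_le le_measure ?inE//=; last exact: measurableI.
have na0 : P (~` row_event X (@above R)) = 0%E.
  have := probability_setC P ma.
  by rewrite (prob_unique_max iidX)// subee.
rewrite -[leRHS]adde0 -na0.
apply: (@le_trans _ _ (P (([set w | amax (random_row X w) <= U]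
    `&` row_event X (@above R)) `|` ~` row_event X (@above R)))).
  apply: le_measure; rewrite ?inE//.
    by apply: measurableU; [exact: measurableI|exact: measurableC].
  move=> w /= wU; have [h|h] := pselect (row_event X (@above R) w); first by left.
  by right.
by apply: measureU2; [exact: measurableI|exact: measurableC].
Qed.

(** The reference event is a unique maximum of modulus at most [U]: at level [y] its section has
    mass [F U - F y], against [1 - F (y + s)] for the gap. Beyond [U] the reference section is
    empty, so the comparison is needed only up to [U]. *)
Lemma prob_gap_lower (q U s : R) : 0 <= q -> 0 <= U -> 0 <= s ->
  (forall y, 0 <= y <= U -> q * (F U - F y) <= 1 - F (y + s)) ->
  ((q * F U ^+ N)%:E <= P (gap_event X s))%E.
Proof.
move=> q0 U0 s0 le_q.
have [->|qn0] := eqVneq q 0; first by rewrite mul0r measure_ge0.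
have {}q0 : 0 < q by rewrite lt_neqAle eq_sym qn0.
rewrite EFinM -prob_above_le// -lee_pdivlMl//.
apply: (prob_row_event_le iidX) => //.
- exact: measurable_gap_set.
- by rewrite invr_ge0 ltW.
- exact: gap_above.
move=> y y0 /=; rewrite lee_pdivlMl// mu_abs_gt ?addr_ge0//.
have [yU|yU] := leP y U; first by rewrite mu_abs_itv// -EFinM lee_fin le_q// y0.
rewrite (_ : [set _ | _] = set0).
  rewrite nuE// measure0 mule0 lee_fin subr_ge0.
  by have /andP[] := muF_itv (addr_ge0 y0 s0).
apply/seteqP; split => x //= /andP[yx xU].
by have := lt_trans yU (lt_le_trans yx xU); rewrite ltxx.
Qed.

(** The reverse comparison with the same reference event. Beyond [U] it is now the section of the
    gap event that must be null, which suits laws of bounded support. *)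
Lemma prob_gap_upper_le (q U s : R) : 0 <= q -> 0 <= U -> 0 <= s ->
  (forall y, 0 <= y <= U -> 1 - F (y + s) <= q * (F U - F y)) ->
  (forall y, U < y -> F (y + s) = 1) ->
  (P (gap_event X s) <= (q * F U ^+ N)%:E)%E.
Proof.
move=> q0 U0 s0 le_q F1; rewrite EFinM -prob_above_le//.
apply: (prob_row_event_le iidX) => //.
- exact: measurable_gap_set.
- exact: gap_above.
move=> y y0 /=; rewrite mu_abs_gt ?addr_ge0//.
have [yU|yU] := leP y U; first by rewrite mu_abs_itv// -EFinM lee_fin le_q// y0.
rewrite F1// subrr mule_ge0// nuE ?measure_ge0//; apply: measurable_bool_set.
by apply: measurable_and; [exact: measurable_fun_ltr|exact: measurable_fun_ler].
Qed.

(** The ratio of tails is the same at every level, so the gap has exactly [q] times the probability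
    of a unique maximum, which is 1. *)
Lemma prob_gap_memoryless (q s : R) : 0 < q -> 0 <= s ->
  (forall y, 0 <= y -> 1 - F (y + s) = q * (1 - F y)) ->
  P (gap_event X s) = q%:E.
Proof.
move=> q0 s0 eq_q; have above1 := prob_unique_max iidX N_gt0 mu_atom.
have mE := measurable_gap_set s; have ma := @measurable_above R.
apply/eqP; rewrite eq_le; apply/andP; split.
  rewrite -[leRHS]mule1 -above1.
  apply: (prob_row_event_le iidX) => //; first exact: ltW.
    exact: gap_above.
  by move=> y y0 /=; rewrite !mu_abs_gt ?addr_ge0// -EFinM eq_q.
rewrite -[leLHS]mule1 -above1 -lee_pdivlMl//.
apply: (prob_row_event_le iidX) => //; first by rewrite invr_ge0 ltW.
  exact: gap_above.
move=> y y0 /=; rewrite !mu_abs_gt ?addr_ge0// -EFinM eq_q//.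
by rewrite mulKf// gt_eqF.
Qed.

(** The ratio of tails is controlled only from [L] on. Replacing [Y_j] by its maximum with [L] makes
    the bound available at every level; the gap events lost in this way satisfy [amax <= L + s],
    which costs [F (L + s) ^ N]. *)
Lemma prob_gap_upper (q L s : R) : 0 <= q -> 0 <= L -> 0 <= s ->
  (forall y, L <= y -> 1 - F (y + s) <= q * (1 - F y)) ->
  (P (gap_event X s) <= (q + F (L + s) ^+ N)%:E)%E.
Proof.
move=> q0 L0 s0 le_q.
pose E : set (R * R) := [set p | Num.max p.1 L + s < `|p.2|].
pose E' : set (R * R) := [set p | Num.max p.1 L < `|p.2|].
have mmax : measurable_fun setT (fun p : R * R => Num.max p.1 L).
  by apply: measurable_maxr => //; exact: measurable_cst.
have mE : measurable E.
  apply: measurable_bool_set; apply: measurable_fun_ltr.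
    by apply: measurable_funD => //; exact: measurable_cst.
  exact: measurableT_comp.
have mE' : measurable E'.
  apply: measurable_bool_set; apply: measurable_fun_ltr => //.
  exact: measurableT_comp.
have E'a : E' `<=` @above R by move=> p; rewrite /E'/= gt_max => /andP[].
have EE' : E `<=` E' by move=> p; apply: le_lt_trans; rewrite lerDl.
have PE : (P (row_event X E) <= q%:E)%E.
  apply: (@le_trans _ _ (q%:E * P (row_event X E'))%E).
    apply: (prob_row_event_le iidX) => //; first exact: subset_trans E'a.
    move=> y y0; rewrite /E/E'/=.
    rewrite !mu_abs_gt ?addr_ge0 ?le_max ?y0// -EFinM lee_fin.
    by apply: le_q; rewrite le_max lexx orbT.
  rewrite -[leRHS]mule1 lee_wpmul2l ?lee_fin//.
  by apply: probability_le1; exact: measurable_row_event.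
have mA : measurable [set w | amax (random_row X w) <= L + s].
  by apply: measurable_bool_set; apply: measurable_fun_ler => //; exact: measurable_amax.
have PA := prob_amax_le iidX (addr_ge0 L0 s0) (muF (addr_ge0 L0 s0)).
rewrite EFinD; apply: le_trans (leeD PE (lexx _)).
rewrite -PA; apply: le_trans (measureU2 _ _ mA); last exact: measurable_row_event.
apply: le_measure; rewrite ?inE.
- exact: measurable_gap_event.
- by apply: measurableU => //; exact: measurable_row_event.
move=> w [j /= hj]; have [xL|xL] := leP `|X j w| (L + s).
  right => /=; apply: amax_le => [|i]; first exact: addr_ge0.
  have [->|ij] := eqVneq i j; first by rewrite mxE.
  rewrite (le_trans (le_amax_but _ ij))// (le_trans _ xL)//.
  by rewrite (le_trans _ (ltW hj))// lerDl.
left; exists j; rewrite /E/= -ltrBrDr gt_max.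
by rewrite !ltrBrDr hj.
Qed.

End gap_bounds.

(** * The law of the absolute value of an entry *)

Section absolute_value_laws.
Context {R : realType}.
Implicit Types c x : R.
Local Notation leb := (@lebesgue_measure R).

(** The domain has at most two points, hence Lebesgue measure 0. *)
Lemma integral_abs_atom (f : R -> R) c : measurable_fun setT f ->
  (\int[leb]_(x in [set x : R | `|x| = c]%R) (f x)%:E)%E = 0%E.
Proof.
move=> mf; have mA : measurable [set x : R | `|x| = c].
  have -> : [set x : R | `|x| = c] = [set x | `|x| == c].
    by apply/seteqP; split => x /= /eqP.
  by apply: measurable_bool_set; exact: measurable_fun_eqr.
apply: null_set_integral => //.
  by apply/measurable_EFinP; exact: measurable_funTS.
apply: countable_lebesgue_measure0.
apply: (@sub_countable _ _ _ ([set c] `|` [set - c])).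
  apply: subset_card_le => x /= <-.
  by case: (leP 0 x) => x0; [left; rewrite ger0_norm|right; rewrite ltr0_norm ?opprK].
by apply: finite_set_countable; rewrite finite_setU; split; exact: finite_set1.
Qed.

Lemma exponential_abs_le c : 0 <= c ->
  exponential_prob 1 [set x : R | `|x| <= c] = (1 - expR (- c))%:E.
Proof.
rewrite le_eqVlt => /orP[/eqP <-|c0].
  rewrite oppr0 expR0 subrr.
  apply: etrans (integral_abs_atom 0 (measurable_exponential_pdf 1)).
  congr (exponential_prob 1 _); apply/seteqP; split => x /=.
    by rewrite normr_le0 => /eqP ->; rewrite normr0.
  by move=> ->.
have -> : [set x : R | `|x| <= c] = `[- c, 0[ `|` `[0, c].
  apply/seteqP; split => x /=; rewrite !in_itv/= ler_norml.
    by move=> /andP[h1 h2]; case: (ltP x 0) => x0; [left; rewrite h1|right].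
  by move=> [/andP[-> /ltW x0]|/andP[x0 ->]]; rewrite ?(le_trans x0)//=
     ?(ltW c0)// andbT (le_trans _ x0)// oppr_le0 ltW.
rewrite /exponential_prob ge0_integral_setU//=; last 3 first.
- apply/measurable_EFinP; apply: measurable_funTS.
  exact: measurable_exponential_pdf.
- by move=> x _; rewrite lee_fin exponential_pdf_ge0.
- apply/disj_set2P; apply/seteqP; split => x //= []; rewrite !in_itv/=.
  by move=> /andP[_ x0] /andP[]; rewrite leNgt x0.
rewrite integral0_eq ?add0e; last first.
  by move=> x /=; rewrite in_itv/= => /andP[_ x0]; rewrite lt0_exponential_pdf.
by have := @exponential_prob_itv0c R 1 c c0; rewrite mulN1r.
Qed.

Lemma exponential_abs_atom c :
  exponential_prob 1 [set x : R | `|x| = c] = 0%E.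
Proof. by apply: integral_abs_atom; exact: measurable_exponential_pdf. Qed.

Lemma uniform_abs_le c : 0 <= c ->
  uniform_prob (@ltr01 R) [set x : R | `|x| <= c] = (Num.min c 1)%:E.
Proof.
move=> c0; rewrite /uniform_prob integral_uniform_pdf.
have -> : [set x : R | `|x| <= c] `&` `[0, 1] = `[0, Num.min c 1]%classic.
  apply/seteqP; split => x /=; rewrite !in_itv/= le_min.
    by move=> [xc /andP[x0 ->]]; rewrite x0 andbT -(ger0_norm x0).
  by move=> /andP[x0 /andP[xc ->]]; rewrite x0 ger0_norm.
rewrite (eq_integral (fun=> 1%E)); last first.
  move=> x; rewrite inE/= in_itv/= le_min => /andP[x0 /andP[_ x1]].
  by rewrite /uniform_pdf x0 x1 subr0 invr1.
rewrite integral_cst//= mul1e lebesgue_measure_itv/= lte_fin.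
case: ltP => h; first by rewrite oppr0 adde0.
by congr EFin; apply/eqP; rewrite eq_le h le_min c0 ler01.
Qed.

Lemma uniform_abs_atom c :
  uniform_prob (@ltr01 R) [set x : R | `|x| = c] = 0%E.
Proof. by apply: integral_abs_atom; exact: measurable_uniform_pdf. Qed.

(** * Bounds for Gaussian tails *)

Section normal_tail.
Variable sigma : R.
Hypothesis sigma_gt0 : 0 < sigma.
Implicit Types m z s U : R.

Let s0 : sigma != 0. Proof. by rewrite gt_eqF. Qed.

Lemma normal_pdfM m x : normal_pdf m sigma x =
  normal_peak sigma * expR (- (x - m) ^+ 2 / (sigma ^+ 2 *+ 2)).
Proof. by rewrite normal_pdfE. Qed.

Definition normal_tail m z : \bar R :=
  (\int[leb]_(x in `[z, +oo[) (normal_pdf m sigma x)%:E)%E.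

Let mpdf m D : measurable_fun D (fun x => (normal_pdf m sigma x)%:E).
Proof.
by apply/measurable_EFinP; apply: measurable_funTS; exact: measurable_normal_pdf.
Qed.

Let mpdfs m s D : measurable_fun D (fun x => (normal_pdf m sigma (x + s))%:E).
Proof.
apply/measurable_EFinP; apply: measurable_funTS.
apply: measurableT_comp; first exact: measurable_normal_pdf.
exact: measurable_funD.
Qed.

(** Puts both tails over the same half-line, so that they can be compared through their densities
    pointwise. *)
Lemma normal_tail_shift m z s : normal_tail m (z + s) =
  (\int[leb]_(x in `[z, +oo[) (normal_pdf m sigma (x + s))%:E)%E.
Proof.
pose F x := x + s.
have F' : F^`()%classic = cst 1.
  apply/funext => x; rewrite /F derive1E deriveD// derive_id derive_cst.
  by rewrite addr0.
have cF : continuous F by move=> x; apply: cvgD; [exact: cvg_id|exact: cvg_cst].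
rewrite /normal_tail -[z + s]/(F z).
rewrite (@increasing_ge0_integration_by_substitutiony R F (normal_pdf m sigma) z).
- by apply: eq_integral => x _; rewrite F' /= fctE mulr1.
- by move=> x y _ _ xy; rewrite /F ltrD2r.
- by move=> x _; rewrite F'; exact: cst_continuous.
- by rewrite F'; exact: is_cvg_cst.
- by rewrite F'; exact: is_cvg_cst.
- split; first by move=> x _; exact: derivableD.
  by apply: cvg_at_right_filter; exact: cF.
- exact: cvg_addrr.
- by apply: continuous_subspaceT; exact: continuous_normal_pdf.
- by move=> x _; exact: normal_pdf_ge0.
Qed.

Lemma normal_tail_ge0 m z : (0 <= normal_tail m z)%E.
Proof. by apply: integral_ge0 => x _; rewrite lee_fin normal_pdf_ge0. Qed.

Lemma normal_tail_le1 m z : (normal_tail m z <= 1)%E.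
Proof.
rewrite -(integral_normal_pdf m sigma); apply: ge0_subset_integral => //; first exact: mpdf.
by move=> x _; rewrite lee_fin normal_pdf_ge0.
Qed.

Lemma normal_tail_fin m z : normal_tail m z \is a fin_num.
Proof.
by rewrite ge0_fin_numE ?normal_tail_ge0// (le_lt_trans (normal_tail_le1 _ _))// ltry.
Qed.

Lemma normal_pdf_shift_le m x s (q : R) :
  - (x + s - m) ^+ 2 / (sigma ^+ 2 *+ 2) <= q - (x - m) ^+ 2 / (sigma ^+ 2 *+ 2) ->
  normal_pdf m sigma (x + s) <= expR q * normal_pdf m sigma x.
Proof.
move=> h; rewrite !normal_pdfM mulrCA ler_wpM2l ?normal_peak_ge0//.
by rewrite -expRD ler_expR [X in _ <= q + X]mulNr.
Qed.

Let sig2 : 0 < sigma ^+ 2 *+ 2.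
Proof. by rewrite pmulrn_lgt0// exprn_gt0. Qed.

(** The density ratio at [x] is [exp (- (2 s (x - m) + s^2) / (2 sigma^2))], largest at [x = z]; the
    term [s^2] is dropped. Writing [|m|] for [m] gives one factor valid for both means [m] and
    [- m], which are the two tails of the modulus. *)
Lemma normal_tail_upper m z s : 0 <= s ->
  (normal_tail m (z + s) <=
   (expR (- (s * (z - `|m|) / sigma ^+ 2)))%:E * normal_tail m z)%E.
Proof.
move=> s_ge0; rewrite normal_tail_shift /normal_tail -ge0_integralZl//; last 2 first.
- exact: mpdf.
- by move=> x _; rewrite lee_fin normal_pdf_ge0.
apply: ge0_le_integral => //.
- by move=> x _; rewrite lee_fin normal_pdf_ge0.
- exact: mpdfs.
- by apply: measurable_funeM; exact: mpdf.
move=> x /=; rewrite in_itv/= andbT => zx; rewrite -EFinM lee_fin.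
apply: normal_pdf_shift_le.
have -> : s * (z - `|m|) / sigma ^+ 2 = 2 * s * (z - `|m|) / (sigma ^+ 2 *+ 2).
  by rewrite -[sigma ^+ 2 *+ 2]mulr_natr; field.
rewrite mulNr -opprD lerN2 -mulrDl ler_pM2r ?invr_gt0//.
have := ler_norm m; have := sqr_ge0 s; have : 0 <= s * (x - z) by rewrite mulr_ge0// subr_ge0.
have : 0 <= s * (`|m| - m) by rewrite mulr_ge0// subr_ge0 ler_norm.
by nra.
Qed.

(** Starting from [|m|] the cross term of the exponent has a favourable sign and is dropped; only
    [s^2] remains, and the other tail is at most 1. *)
Lemma normal_tail_gauss m s : 0 <= s ->
  (normal_tail m (`|m| + s) <= (expR (- (s ^+ 2 / (sigma ^+ 2 *+ 2))))%:E)%E.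
Proof.
move=> s_ge0; rewrite normal_tail_shift.
apply: (@le_trans _ _ ((expR (- (s ^+ 2 / (sigma ^+ 2 *+ 2))))%:E * normal_tail m `|m|)%E).
  rewrite /normal_tail -ge0_integralZl//; last 2 first.
  - exact: mpdf.
  - by move=> x _; rewrite lee_fin normal_pdf_ge0.
  apply: ge0_le_integral => //.
  - by move=> x _; rewrite lee_fin normal_pdf_ge0.
  - exact: mpdfs.
  - by apply: measurable_funeM; exact: mpdf.
  move=> x /=; rewrite in_itv/= andbT => zx; rewrite -EFinM lee_fin.
  apply: normal_pdf_shift_le.
  rewrite mulNr -opprD lerN2 -mulrDl ler_pM2r ?invr_gt0//.
  have : 0 <= s * (x - m) by rewrite mulr_ge0// subr_ge0 (le_trans (ler_norm m)).
  by nra.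
rewrite -[leRHS]mule1 lee_wpmul2l ?lee_fin ?expR_ge0//.
exact: normal_tail_le1.
Qed.

(** The density ratio decreases in [x], so a lower bound requires a cut at [U]. The mass beyond [U]
    reappears as the correction [q * normal_tail m U], which matches the difference [F U - F y] of
    [prob_gap_lower]. *)
Lemma normal_tail_lower m z U s : 0 <= s -> 0 <= z -> z <= U ->
  forall q, q = expR (- ((2 * s * (U + `|m|) + s ^+ 2) / (sigma ^+ 2 *+ 2))) ->
  (q%:E * normal_tail m z <= normal_tail m (z + s) + q%:E * normal_tail m U)%E.
Proof.
move=> s_ge0 z0 zU q qE.
have q0 : (0 <= q%:E)%E by rewrite lee_fin qE expR_ge0.
have -> : normal_tail m z =
    (\int[leb]_(x in `[z, U[) (normal_pdf m sigma x)%:E + normal_tail m U)%E.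
  rewrite /normal_tail -ge0_integral_setU//.
  - congr (integral _ _ _); apply/seteqP; split => x /=; rewrite !in_itv/= !andbT.
      by move=> zx; case: (ltP x U) => xU; [left; rewrite zx|right].
    by move=> [/andP[]//|]; exact: le_trans.
  - exact: mpdf.
  - by move=> x _; rewrite lee_fin normal_pdf_ge0.
  - apply/disj_set2P; apply/seteqP; split => x //= []; rewrite !in_itv/= andbT.
    by move=> /andP[_ xU]; rewrite leNgt xU.
rewrite ge0_muleDr; last 2 first.
- by apply: integral_ge0 => x _; rewrite lee_fin normal_pdf_ge0.
- exact: normal_tail_ge0.
rewrite leeD2r// normal_tail_shift.
apply: (@le_trans _ _ (\int[leb]_(x in `[z, U[) (normal_pdf m sigma (x + s))%:E)%E).
  rewrite -ge0_integralZl//; last 2 first.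
  - exact: mpdf.
  - by move=> x _; rewrite lee_fin normal_pdf_ge0.
  apply: ge0_le_integral => //.
  - by move=> x _; rewrite mule_ge0// lee_fin normal_pdf_ge0.
  - by apply: measurable_funeM; exact: mpdf.
  - exact: mpdfs.
  move=> x /=; rewrite in_itv/= => /andP[zx xU]; rewrite -EFinM lee_fin.
  rewrite !normal_pdfM mulrCA ler_wpM2l ?normal_peak_ge0// qE -expRD ler_expR.
  rewrite !mulNr -opprD lerN2 -mulrDl ler_pM2r ?invr_gt0//.
  have : 0 <= s * (U - x) by rewrite mulr_ge0// subr_ge0 ltW.
  have : 0 <= s * (`|m| + m).
    by rewrite mulr_ge0// -[m in _ + m]opprK subr_ge0 -normrN ler_norm.
  by nra.
apply: ge0_subset_integral => //.
- exact: mpdfs.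
- by move=> x _; rewrite lee_fin normal_pdf_ge0.
- by move=> x /=; rewrite !in_itv/= andbT => /andP[].
Qed.

(** The interval from [z] to [z + 1] carries enough mass: there [|x - m| <= z + 1 + |m|]. *)
Lemma normal_tail_ge m z : 0 <= z ->
  ((normal_peak sigma * expR (- ((z + 1 + `|m|) ^+ 2 / (sigma ^+ 2 *+ 2))))%:E
   <= normal_tail m z)%E.
Proof.
move=> z0; set c := _ * expR _.
have c0 : 0 <= c by rewrite mulr_ge0 ?normal_peak_ge0 ?expR_ge0.
apply: (@le_trans _ _ (\int[leb]_(x in `[z, (z + 1)%R]) c%:E)%E).
  rewrite integral_cst//= lebesgue_measure_itv/= lte_fin ltrDl ltr01.
  by rewrite -EFinD addrAC subrr add0r mule1.
apply: (@le_trans _ _ (\int[leb]_(x in `[z, (z + 1)%R]) (normal_pdf m sigma x)%:E)%E).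
  apply: ge0_le_integral => //; first exact: mpdf.
  move=> x /=; rewrite in_itv/= => /andP[zx xz]; rewrite lee_fin normal_pdfM.
  rewrite ler_wpM2l ?normal_peak_ge0// ler_expR mulNr lerN2 ler_pM2r ?invr_gt0//.
  rewrite -[leLHS]real_normK ?num_real// lerXn2r ?nnegrE ?addr_ge0//.
  rewrite (le_trans (ler_normB _ _))// lerD2r ger0_norm//.
  exact: le_trans zx.
apply: ge0_subset_integral => //.
- exact: mpdf.
- by move=> x _; rewrite lee_fin normal_pdf_ge0.
- by move=> x /=; rewrite !in_itv/= andbT => /andP[].
Qed.

Lemma normal_tailN m z :
  (\int[leb]_(x in `]-oo, (- z)%R]) (normal_pdf m sigma x)%:E)%E = normal_tail (- m) z.
Proof.
rewrite ge0_integration_by_substitutionNy.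
- apply: eq_integral => x _; rewrite [(_ \o _) _]/= !normal_pdfM.
  have -> : - x - m = - (x - - m) by rewrite opprK opprD.
  by rewrite sqrrN.
- by apply: continuous_subspaceT; exact: continuous_normal_pdf.
- by move=> x _; exact: normal_pdf_ge0.
Qed.

(** The left tail for the mean [m] is by reflection a right tail for the mean [- m], so only right
    tails have to be estimated. *)
Definition normal_abs_cdf m c : R :=
  1 - (fine (normal_tail m c) + fine (normal_tail (- m) c)).

Lemma normal_abs_le m c : 0 <= c ->
  normal_prob m sigma [set x : R | `|x| <= c] = (normal_abs_cdf m c)%:E.
Proof.
move=> c0.
have mA : measurable [set x : R | `|x| <= c].
  by apply: measurable_bool_set; exact: measurable_fun_ler.
have := probability_setC (normal_prob m sigma) (measurableC mA).
rewrite setCK => ->; rewrite /normal_abs_cdf EFinB; congr (1 - _)%E.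
rewrite EFinD !fineK ?normal_tail_fin// -normal_tailN.
rewrite (_ : ~` _ = `]c, +oo[ `|` `]-oo, - c[); last first.
  apply/seteqP; split => x /=; rewrite !in_itv/= ?andbT.
    move=> /negP; rewrite -ltNge ltrNr ltr_normr => /orP[]; [by left|].
    by rewrite ltrNr; right.
  move=> h; apply/negP; rewrite -ltNge ltr_normr; apply/orP; case: h; first by left.
  by rewrite ltrNr; right.
transitivity (\int[leb]_(x in (`]c, +oo[%classic `|` `]-oo, (- c)%R[%classic))
    (normal_pdf m sigma x)%:E)%E; first by [].
rewrite ge0_integral_setU//=; last 3 first.
- exact: mpdf.
- by move=> x _; rewrite lee_fin normal_pdf_ge0.
- apply/disj_set2P; apply/seteqP; split => x //= []; rewrite !in_itv/= andbT.
  move=> cx xc; have := lt_trans (le_lt_trans c0 cx) xc.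
  by rewrite ltNge oppr_le0 c0.
congr (_ + _)%E; last by rewrite integral_itv_bndo_bndc//; exact: mpdf.
by rewrite /normal_tail integral_itv_obnd_cbnd//; exact: mpdf.
Qed.

Lemma normal_abs_atom m c :
  normal_prob m sigma [set x : R | `|x| = c] = 0%E.
Proof. by apply: integral_abs_atom; exact: measurable_normal_pdf. Qed.

End normal_tail.
End absolute_value_laws.

(** * Limit laws *)

Section limits.
Context {R : realType} (d : nat -> measure_display).
Context (T : forall N, measurableType (d N)) (P : forall N, probability (T N) R).

(** Transfers a limit between events that agree outside a set of vanishing probability. That set
    will be [amax <= c], where the row may be too small for the deterministic description of
    [stsp]. *)
Lemma cvg_prob_off (S E B : forall N, set (T N)) (l : R) :
  (\forall N \near \oo, [/\ measurable (S N), measurable (E N), measurable (B N)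
     & forall w, ~ B N w -> (S N w <-> E N w)]) ->
  P N (B N) @[N --> \oo] --> 0%E -> P N (E N) @[N --> \oo] --> l%:E ->
  P N (S N) @[N --> \oo] --> l%:E.
Proof.
move=> SEB PB PE.
apply: (@squeeze_cvge _ _ _ _ (fun N => P N (E N) - P N (B N))%E _
  (fun N => P N (E N) + P N (B N))%E).
- near=> N; have [mS mE mB SE] : [/\ measurable (S N), measurable (E N),
    measurable (B N) & forall w, ~ B N w -> (S N w <-> E N w)] by near: N.
  apply/andP; split.
    rewrite leeBlDr ?fin_num_measure//; apply: le_trans (measureU2 _ mS mB).
    apply: le_measure; rewrite ?inE//; first exact: measurableU.
    by move=> w Ew; have [|/SE h] := pselect (B N w); [right|left; apply/h].
  apply: le_trans (measureU2 _ mE mB).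
  apply: le_measure; rewrite ?inE//; first exact: measurableU.
  by move=> w Sw; have [|/SE h] := pselect (B N w); [right|left; apply/h].
- by rewrite -[l%:E]sube0; apply: cvgeB => //; rewrite fin_num_adde_defl.
- by rewrite -[l%:E]adde0; apply: cvgeD => //; rewrite fin_num_adde_defl.
Unshelve. all: by end_near. Qed.

Variables (lam y : R).
Hypothesis lam_gt0 : 0 < lam.
Variable X : forall N, 'I_N -> {RV (P N) >-> R}.
Variable mu : set R -> \bar R.
Hypothesis iidX : forall N, iid_with_law (@X N) mu.
Variable F : R -> R.
Hypothesis muF : forall c, 0 <= c -> mu [set x | `|x| <= c] = (F c)%:E.
Hypothesis mu_atom : forall c, 0 <= c -> mu [set x | `|x| = c] = 0%E.

Lemma cvg_prob_amax_le c : 0 <= c -> F c < 1 ->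
  P N [set w | amax (random_row (@X N) w) <= c] @[N --> \oo] --> 0%E.
Proof.
move=> c0 F1; have F0 : 0 <= F c.
  by have /andP[] := muF_itv (iidX 1) isT muF c0.
rewrite (_ : (fun N => _) = fun N => ((F c) ^+ N)%:E); last first.
  by apply/funext => N; rewrite (prob_amax_le (iidX N) c0 (muF c0)).
by apply: cvg_EFin; [exact: nearW|apply: cvg_expr; rewrite ger0_norm].
Qed.

Let stspX N w := stsp lam (const_mx y) (random_row (@X N) w).

Let mB c N : measurable [set w | amax (random_row (@X N) w) <= c].
Proof.
by apply: measurable_bool_set; apply: measurable_fun_ler => //; exact: measurable_amax.
Qed.

Lemma cvg_prob_stsp_lt_large t c : 0 < t -> `|y| <= t -> lam / t <= c -> F c < 1 ->
  P N [set w | (stspX w < t%:E)%E] @[N --> \oo] --> 1%E.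
Proof.
move=> t0 yt lc F1; have c0 : 0 <= c by apply: le_trans lc; rewrite divr_ge0// ltW.
apply: (@cvg_prob_off _ (fun N => setT)
  (fun N => [set w | amax (random_row (@X N) w) <= c])).
- near=> N; have N1 : (1 < N)%N by near: N; exact: nbhs_infty_gt.
  split => //; first exact: measurable_stsp_lt.
  move=> w /negP; rewrite -ltNge => cw; split => // _.
  apply: stsp_lt_amax => //; first exact: ltnW.
  exact: le_lt_trans cw.
- exact: cvg_prob_amax_le.
- by under eq_fun do rewrite probability_setT; exact: cvg_cst.
Unshelve. all: by end_near. Qed.

Lemma cvg_prob_stsp_lt_gap t c l : 0 < t < `|y| ->
  t + lam / (2 * (`|y| - t)) <= c -> F c < 1 ->
  P N (gap_event (@X N) (2 * t)) @[N --> \oo] --> l%:E ->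
  P N [set w | (stspX w < t%:E)%E] @[N --> \oo] --> (1 - l)%:E.
Proof.
move=> /andP[t0 ty] tc F1 Pl.
have c0 : 0 <= c.
  by apply: le_trans tc; rewrite addr_ge0 ?divr_ge0 ?mulr_ge0 ?subr_ge0 ?ltW.
apply: (@cvg_prob_off _ (fun N => ~` gap_event_closed (@X N) (2 * t))
  (fun N => [set w | amax (random_row (@X N) w) <= c])).
- near=> N; have N1 : (1 < N)%N by near: N; exact: nbhs_infty_gt.
  split => //.
  + exact: measurable_stsp_lt.
  + by apply: measurableC; exact: measurable_gap_event_closed.
  move=> w /negP; rewrite -ltNge => cw.
  have rob := amax_robust lam_gt0 ty (ltW t0) (le_lt_trans tc cw).
  rewrite /stspX /= (stsp_lt_robust lam_gt0 N1 rob) ?t0 ?lexx//.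
  by split=> h /gap_event_closedE.
- exact: cvg_prob_amax_le.
(* The strict inequality on [stsp] leads to the closed gap event; it has the same probability as the
   open one, whose limit is given. *)
- apply: (@cvg_trans _ ((1 - P N (gap_event (@X N) (2 * t)))%E @[N --> \oo])).
    apply: near_eq_cvg; near=> N.
    have N0 : (0 < N)%N by near: N; exact: nbhs_infty_gt.
    rewrite probability_setC; last exact: measurable_gap_event_closed.
    by rewrite (prob_gap_event_closed (iidX N) N0 muF mu_atom)// mulr_gt0.
  by rewrite EFinB; apply: cvgeB => //; exact: cvg_cst.
Unshelve. all: by end_near. Qed.

Lemma cvg_prob_scaled_stsp_le (K : nat -> R) (tau c r l : R) :
  0 < tau < `|y| -> tau + lam / (2 * (`|y| - tau)) <= c -> F c < 1 ->
  0 <= r -> (\forall N \near \oo, 0 < K N) ->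
  (\forall N \near \oo, r / K N < tau) ->
  P N (gap_event (@X N) (2 * (r / K N))) @[N --> \oo] --> l%:E ->
  P N [set w | ((K N)%:E * stspX w <= r%:E)%E] @[N --> \oo] --> (1 - l)%:E.
Proof.
move=> /andP[t0 ty] tc F1 r0 K0 rK Pl.
have c0 : 0 <= c.
  by apply: le_trans tc; rewrite addr_ge0 ?divr_ge0 ?mulr_ge0 ?subr_ge0 ?ltW.
apply: (@cvg_prob_off _ (fun N => ~` gap_event (@X N) (2 * (r / K N)))
  (fun N => [set w | amax (random_row (@X N) w) <= c])).
- near=> N; have N1 : (1 < N)%N by near: N; exact: nbhs_infty_gt.
  have KN : 0 < K N by near: N.
  have stspE w : ((K N)%:E * stspX w <= r%:E)%E = (stspX w <= (r / K N)%:E)%E.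
    by rewrite -lee_pdivlMl// -EFinM mulrC.
  split => //.
  + by under eq_set do rewrite stspE; exact: measurable_stsp_le.
  + by apply: measurableC; exact: measurable_gap_event.
  move=> w /negP; rewrite -ltNge => cw /=.
  have rob := amax_robust lam_gt0 ty (ltW t0) (le_lt_trans tc cw).
  rewrite stspE /stspX (stsp_le_robust lam_gt0 N1 rob); last first.
    by rewrite divr_ge0 ?(ltW KN)//=; near: N.
  by split=> h /gap_eventE.
- exact: cvg_prob_amax_le.
- rewrite (_ : (fun N => _) =
      fun N => (1 - P N (gap_event (@X N) (2 * (r / K N))))%E); last first.
    by apply/funext => N; rewrite probability_setC//; exact: measurable_gap_event.
  by rewrite EFinB; apply: cvgeB => //; exact: cvg_cst.
Unshelve. all: by end_near. Qed.

Lemma cvg_prob_scaled_stsp_le_lt0 (K : nat -> R) (r : R) : r < 0 ->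
  (\forall N \near \oo, 0 < K N) ->
  P N [set w | ((K N)%:E * stspX w <= r%:E)%E] @[N --> \oo] --> 0%E.
Proof.
move=> r0 K0; apply: cvg_near_cst; near=> N.
rewrite (_ : [set _ | _] = set0) ?measure0//; apply/seteqP; split => // w /=.
move=> h; have : (0 <= r%:E)%E.
  apply: le_trans h; apply: mule_ge0; last exact: stsp_ge0.
  by rewrite lee_fin ltW//; near: N.
by rewrite lee_fin leNgt r0.
Unshelve. all: by end_near. Qed.

End limits.

Section exponential_cdf.
Context {R : realType}.

Lemma exponential_prob_itvNyc (rate r : R) : 0 < rate ->
  exponential_prob rate `]-oo, r]%classic =
  (if 0 <= r then 1 - expR (- (rate * r)) else 0)%:E.
Proof.
move=> rate0.
have mE D : measurable_fun D (EFin \o exponential_pdf rate).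
  apply: measurable_funTS; apply/measurable_EFinP.
  exact: measurable_exponential_pdf.
have neg0 (D : set R) : (forall x, D x -> x < 0) ->
    (\int[lebesgue_measure]_(x in D) (exponential_pdf rate x)%:E = 0)%E.
  by move=> D0; apply: integral0_eq => x /D0 x0; rewrite lt0_exponential_pdf.
have itv0 : exponential_prob rate `]-oo, 0[%classic = 0%E.
  by apply: neg0 => x /=; rewrite in_itv/=.
case: ifPn => [|r0]; last first.
  apply: neg0 => x /=; rewrite in_itv/= => xr.
  by rewrite (le_lt_trans xr)// real_ltNge ?num_real.
rewrite le_eqVlt => /orP[/eqP <-|r0].
  rewrite mulr0 oppr0 expR0 subrr /exponential_prob.
  by rewrite -integral_itv_bndo_bndc//; exact: mE.
have -> : `]-oo, r]%classic = `]-oo, 0[ `|` `[0, r] :> set R.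
  apply/seteqP; split => x /=; rewrite !in_itv/=.
    by move=> xr; case: (ltP x 0) => x0; [left|right].
  by move=> [x0|/andP[]//]; rewrite (le_trans (ltW x0))// ltW.
have := exponential_prob_itv0c rate r0; move: itv0; rewrite /exponential_prob => i0 i1.
rewrite ge0_integral_setU//=; last 3 first.
- exact: mE.
- by move=> x _; rewrite lee_fin exponential_pdf_ge0// ltW.
- apply/disj_set2P; apply/seteqP; split => x //= []; rewrite !in_itv/=.
  by move=> x0 /andP[]; rewrite leNgt x0.
by rewrite i0 add0e i1 mulNr.
Qed.

End exponential_cdf.

(** * Elementary bounds on powers, and the normalising sequence of the normal law *)

Lemma bernoulli_ineq (R : realDomainType) (x : R) n : 0 <= x <= 1 ->
  1 - n%:R * (1 - x) <= x ^+ n.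
Proof.
move=> /andP[x0 x1]; elim: n => [|n IH]; first by rewrite mul0r subr0 expr0.
have : x * (1 - n%:R * (1 - x)) <= x * x ^+ n by rewrite ler_wpM2l.
rewrite exprS -natr1.
have : 0 <= n%:R * (1 - x) * (1 - x) by rewrite !mulr_ge0// ?subr_ge0.
by lra.
Qed.

Lemma expr_le_expR (R : realType) (x : R) n : 0 <= x ->
  x ^+ n <= expR (- (n%:R * (1 - x))).
Proof.
move=> x0; rewrite -mulrN expRM_natl lerXn2r ?nnegrE ?expR_ge0//.
by have := expR_ge1Dx (- (1 - x)); rewrite opprB addrC subrK.
Qed.

Section sqrt_ln.
Context {R : realType}.

(** Normalised by [exp (u^2 / 2) = N]; the largest of [N] standard Gaussian moduli is of this
    order. *)
Definition sqrt2ln (N : nat) : R := Num.sqrt (2 * ln N%:R).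

Lemma sqrt2ln_sqr N : (0 < N)%N -> sqrt2ln N ^+ 2 = 2 * ln N%:R.
Proof. by move=> N0; rewrite sqr_sqrtr// mulr_ge0// ln_ge0// ler1n. Qed.

Lemma expR_sqrt2ln N : (0 < N)%N -> expR (sqrt2ln N ^+ 2 / 2) = N%:R.
Proof.
move=> N0; rewrite sqrt2ln_sqr// mulrC mulKf// lnK// posrE ltr0n //.
Qed.

Lemma cvg_sqrt2ln : sqrt2ln N @[N --> \oo] --> +oo.
Proof.
apply/cvgryPge => A; near=> N.
have N0 : (0 < N)%N by near: N; exact: nbhs_infty_gt.
have h : expR (A ^+ 2 / 2) <= N%:R by near: N; exact: nbhs_infty_ger.
apply: (le_trans (ler_norm A)); rewrite -(sqrtr_sqr A) ler_wsqrtr//.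
rewrite mulrC -ler_pdivrMr// -ler_expR lnK// posrE ltr0n//.
Unshelve. all: by end_near. Qed.

Lemma cvg_sqrt2lnV : (sqrt2ln N)^-1 @[N --> \oo] --> (0 : R).
Proof.
apply/(gtr0_cvgV0 (f := sqrt2ln)); last exact: cvg_sqrt2ln.
exact: (cvgryPgt _).1 cvg_sqrt2ln 0.
Qed.

End sqrt_ln.

(** * The gap for the normal law *)

Section normal_gap_exponents.
Context {R : realType}.
Variables sigma u r a : R.
Hypotheses (sigma0 : sigma != 0) (u0 : u != 0).

(** With [a = |m|] and [s = r / u], the right-hand side is the numerator of the tail exponent at the
    cut-off [U]. The left-hand side contains [u] only through [u^-1], so its limit is read off by
    setting [u^-1] to 0. The next identity does the same for the cut-off [L]. *)
Lemma normal_exponent_lower :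
  2 * r * (sigma + u^-1 * (sigma + 2 * a)) + r ^+ 2 * u^-1 ^+ 2 =
  2 * (r / u) * (a + sigma * (u + 1) + a) + (r / u) ^+ 2.
Proof. by field. Qed.

Lemma normal_exponent_upper :
  r * (sigma - u^-1 * (sigma + 1 + 2 * a) - r * u^-1 ^+ 2) =
  r / u * (sigma * (u - 1) - 1 - a - r / u - a).
Proof. by field. Qed.

Lemma normal_exponent_gauss (v : R) :
  (sigma * v) ^+ 2 / (sigma ^+ 2 *+ 2) = v ^+ 2 / 2.
Proof. by rewrite -[_ *+ 2]mulr_natr; field. Qed.

End normal_gap_exponents.

Section normal_gap.
Context {R : realType} (d : nat -> measure_display).
Context (T : forall N, measurableType (d N)) (P : forall N, probability (T N) R).
Variables (m sigma : R).
Hypothesis sigma_gt0 : 0 < sigma.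
Variable X : forall N, 'I_N -> {RV (P N) >-> R}.
Hypothesis iidX : forall N, iid_with_law (@X N) (normal_prob m sigma).

Let F := normal_abs_cdf sigma m.
Let muF c : 0 <= c -> normal_prob m sigma [set x | `|x| <= c] = (F c)%:E.
Proof. exact: normal_abs_le. Qed.
Let atom c (_ : 0 <= c) := @normal_abs_atom R sigma m c.
Let t1 c := fine (normal_tail sigma m c).
Let t2 c := fine (normal_tail sigma (- m) c).

Let FE c : 1 - F c = t1 c + t2 c.
Proof. by rewrite /F /normal_abs_cdf opprB addrC subrK. Qed.

Let tE k c : (fine (normal_tail sigma k c))%:E = normal_tail sigma k c.
Proof. by rewrite fineK// normal_tail_fin. Qed.

Let tail_upper L s y : 0 <= s -> L <= y ->
  1 - F (y + s) <= expR (- (s * (L - `|m|) / sigma ^+ 2)) * (1 - F y).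
Proof.
move=> s0 Ly; rewrite !FE.
have up k : `|k| = `|m| -> fine (normal_tail sigma k (y + s)) <=
    expR (- (s * (L - `|m|) / sigma ^+ 2)) * fine (normal_tail sigma k y).
  move=> km; rewrite -lee_fin EFinM !tE.
  apply: le_trans (normal_tail_upper sigma_gt0 k y s0) _.
  rewrite lee_wpmul2r ?normal_tail_ge0// lee_fin ler_expR lerN2 km.
  by rewrite ler_pM2r ?invr_gt0 ?exprn_gt0// ler_wpM2l// lerB.
by rewrite mulrDr lerD ?up// normrN.
Qed.

Let tail_lower U s y : 0 <= s -> 0 <= y <= U ->
  expR (- ((2 * s * (U + `|m|) + s ^+ 2) / (sigma ^+ 2 *+ 2))) * (F U - F y)
  <= 1 - F (y + s).
Proof.
move=> s0 /andP[y0 yU].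
have -> : F U - F y = (t1 y + t2 y) - (t1 U + t2 U).
  by rewrite -!FE; move: (F U) (F y) => b c; ring.
rewrite FE; set q := expR _.
have lo k : `|k| = `|m| -> q * fine (normal_tail sigma k y) <=
    fine (normal_tail sigma k (y + s)) + q * fine (normal_tail sigma k U).
  move=> km; rewrite -lee_fin EFinD !EFinM !tE.
  by apply: normal_tail_lower => //; rewrite km.
rewrite mulrBr lerBlDr !mulrDr addrACA.
exact: lerD (lo m erefl) (lo (- m) (normrN m)).
Qed.

Let normal_gap_ge r u N : (0 < N)%N -> 0 <= r -> 0 < u ->
  expR (u ^+ 2 / 2) = N%:R ->
  expR (- ((2 * r * (sigma + u^-1 * (sigma + 2 * `|m|)) + r ^+ 2 * u^-1 ^+ 2)
     / (sigma ^+ 2 *+ 2))) * (1 - 2 * expR (- u))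
  <= fine (P N (gap_event (@X N) (r / u))).
Proof.
move=> N0 r0 uN0 uNE; set s := r / u; set q := expR _.
have s0 : 0 <= s by rewrite divr_ge0// ltW.
(* With this U, N P(|a| > U) <= 2 exp(-u). *)
pose U := `|m| + sigma * (u + 1).
have U0 : 0 <= U by rewrite addr_ge0// mulr_ge0 ?addr_ge0// ltW.
have qE : q = expR (- ((2 * s * (U + `|m|) + s ^+ 2) / (sigma ^+ 2 *+ 2))).
  by rewrite /q /U /s normal_exponent_lower ?gt_eqF.
have := prob_gap_lower (iidX N) N0 muF atom (expR_ge0 _) U0 s0
  (fun y => @tail_lower U s y s0).
rewrite -qE -[P N _]fineK ?fin_num_measure ?lee_fin//; last exact: measurable_gap_event.
apply: le_trans; apply: ler_wpM2l; first exact: expR_ge0.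
apply: le_trans (bernoulli_ineq N (muF_itv (iidX N) N0 muF U0)).
apply: lerB => //; rewrite FE.
have tg k : `|k| = `|m| ->
    fine (normal_tail sigma k U) <= expR (- ((u + 1) ^+ 2 / 2)).
  move=> km; rewrite -lee_fin tE /U -km.
  apply: le_trans (normal_tail_gauss sigma_gt0 k _) _.
    by rewrite mulr_ge0 ?addr_ge0// ltW.
  by rewrite lee_fin normal_exponent_gauss// gt_eqF.
have : N%:R * (t1 U + t2 U) <= N%:R * (2 * expR (- ((u + 1) ^+ 2 / 2))).
  apply: (ler_wpM2l (ler0n R N)); rewrite mulr_natl mulr2n; apply: lerD; first exact: tg.
  by apply: tg; exact: normrN.
(* [u^2 / 2 - (u + 1)^2 / 2 = - u - 1/2], which is at most [- u]. *)
move=> /le_trans; apply; rewrite mulrCA ler_pM2l// -[in leLHS]uNE -expRD.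
by rewrite ler_expR; have := ltW uN0; nra.
Qed.

Let normal_gap_le r u N : (0 < N)%N -> 0 <= r -> 0 < u ->
  expR (u ^+ 2 / 2) = N%:R ->
  0 <= sigma * (u - 1) - 1 - `|m| - r / u ->
  fine (P N (gap_event (@X N) (r / u))) <=
  expR (- (r * (sigma - u^-1 * (sigma + 1 + 2 * `|m|) - r * u^-1 ^+ 2)
     / sigma ^+ 2)) + expR (- (normal_peak sigma * u)).
Proof.
(* L + s = sigma (u - 1) - 1 - |m| is just small enough for N P(|a| > L + s) to
   grow at least like u. *)
move=> N0 r0 uN0 uNE; set s := r / u; set L := _ - s => L0; set q := expR _.
have s0 : 0 <= s by rewrite divr_ge0// ltW.
have qE : q = expR (- (s * (L - `|m|) / sigma ^+ 2)).
  by rewrite /q /L /s normal_exponent_upper ?gt_eqF.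
have := prob_gap_upper (iidX N) N0 muF (expR_ge0 _) L0 s0
  (fun y => @tail_upper L s y s0).
rewrite -qE -[P N _]fineK ?fin_num_measure ?lee_fin//; last exact: measurable_gap_event.
move=> /le_trans; apply; rewrite lerD2l.
have Ls0 : 0 <= L + s by rewrite addr_ge0.
have /andP[F0 _] := muF_itv (iidX N) N0 muF Ls0.
apply: le_trans (expr_le_expR N F0) _; rewrite ler_expR lerN2 FE.
have t2_0 : 0 <= t2 (L + s) by rewrite fine_ge0// normal_tail_ge0.
apply: (@le_trans _ _ (N%:R * t1 (L + s))); last by rewrite ler_wpM2l// lerDl.
apply: (@le_trans _ _ (N%:R * (normal_peak sigma * expR (- ((u - 1) ^+ 2 / 2))))).
  rewrite mulrCA; apply: ler_wpM2l; first exact: normal_peak_ge0.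
  rewrite -[in leRHS]uNE -expRD.
  (* [u^2 / 2 - (u - 1)^2 / 2 = u - 1/2], and [exp (u - 1/2) >= u + 1/2 >= u]. *)
  apply: le_trans (expR_ge1Dx _); nra.
apply: (ler_wpM2l (ler0n R N)); rewrite -lee_fin tE.
apply: le_trans (normal_tail_ge sigma_gt0 m Ls0).
have -> : L + s + 1 + `|m| = sigma * (u - 1).
  by rewrite /L subrK; move: `|m| => a; ring.
by rewrite normal_exponent_gauss// gt_eqF.
Qed.

(** Near the level [sigma * u] the tail decreases over a distance [r / u] by a factor close to [exp
    (- sigma u (r / u) / sigma^2) = exp (- r / sigma)]. Both bounds tend to it, and the truncation
    costs vanish as [u] grows. *)
Lemma cvg_normal_gap r : 0 <= r ->
  P N (gap_event (@X N) (r / sqrt2ln N)) @[N --> \oo] --> (expR (- (1 / sigma * r)))%:E.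
Proof.
move=> r0.
have cu := @cvg_sqrt2ln R; have cv := @cvg_sqrt2lnV R.
suff : fine (P N (gap_event (@X N) (r / sqrt2ln N))) @[N --> \oo]
    --> expR (- (1 / sigma * r)).
  move=> h; apply: cvg_EFin; last exact: h.
  by apply: nearW => N; rewrite fin_num_measure//; exact: measurable_gap_event.
have cexpu : expR (- sqrt2ln N) @[N --> \oo] --> (0 : R).
  exact: (cvg_comp _ _ cu (@cvgr_expR R)).
apply: (squeeze_cvgr (f := fun N => expR (- ((2 * r * (sigma +
     (sqrt2ln N)^-1 * (sigma + 2 * `|m|)) + r ^+ 2 * (sqrt2ln N)^-1 ^+ 2)
     / (sigma ^+ 2 *+ 2))) * (1 - 2 * expR (- sqrt2ln N))) (h := fun N =>
  expR (- (r * (sigma - (sqrt2ln N)^-1 * (sigma + 1 + 2 * `|m|) - r * (sqrt2ln N)^-1 ^+ 2)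
     / sigma ^+ 2)) + expR (- (normal_peak sigma * sqrt2ln N)))).
- near=> N.
  have N0 : (0 < N)%N by near: N; exact: nbhs_infty_gt.
  have u1 : 1 <= sqrt2ln N :> R by near: N; move/cvgryPge: cu; exact.
  have uN0 : 0 < sqrt2ln N :> R by exact: lt_le_trans u1.
  have uNE := @expR_sqrt2ln R _ N0.
  rewrite normal_gap_ge//= normal_gap_le//.
  (* Large enough for the cut-off [L] of the upper bound to be nonnegative, using [r / u <= r]. *)
  have uL : 1 + (1 + `|m| + r) / sigma <= sqrt2ln N by near: N; move/cvgryPge: cu; exact.
  have ru : r / sqrt2ln N <= r by rewrite ler_pdivrMr// ler_peMr.
  have : 1 + `|m| + r <= sigma * (sqrt2ln N - 1).
    by rewrite -ler_pdivrMl// mulrC lerBrDl.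
  by lra.
- have -> : expR (- (1 / sigma * r)) =
      expR (- ((2 * r * (sigma + 0 * (sigma + 2 * `|m|)) + r ^+ 2 * 0 ^+ 2)
        / (sigma ^+ 2 *+ 2))) * (1 - 2 * 0).
    rewrite mulr0 subr0 mulr1 -[_ *+ 2]mulr_natr; congr (expR (- _)).
    by field; rewrite gt_eqF.
  apply: cvgM; last first.
    by apply: cvgB; [exact: cvg_cst|apply: cvgM; [exact: cvg_cst|exact: cexpu]].
  apply: (cvg_comp _ expR); last exact: continuous_expR.
  apply: cvgN; apply: cvgM; last exact: cvg_cst.
  apply: cvgD.
    apply: cvgM; first exact: cvg_cst.
    apply: cvgD; first exact: cvg_cst.
    by apply: cvgM; [exact: cv|exact: cvg_cst].
  apply: cvgM; first exact: cvg_cst.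
  by rewrite !expr2; apply: cvgM; exact: cv.
- have -> : expR (- (1 / sigma * r)) =
      expR (- (r * (sigma - 0 * (sigma + 1 + 2 * `|m|) - r * 0 ^+ 2) / sigma ^+ 2)) + 0.
    by rewrite addr0; congr (expR (- _)); field; rewrite gt_eqF.
  apply: cvgD; last first.
    have p0 : 0 < normal_peak sigma by rewrite normal_peak_gt0// gt_eqF.
    have cpu : normal_peak sigma * sqrt2ln N @[N --> \oo] --> +oo.
      exact: (cvg_comp _ _ cu (gt0_cvgMry p0 cvg_id)).
    exact: (cvg_comp _ _ cpu (@cvgr_expR R)).
  apply: (cvg_comp _ expR); last exact: continuous_expR.
  apply: cvgN; apply: cvgM; last exact: cvg_cst.
  apply: cvgM; first exact: cvg_cst.
  apply: cvgB.
    apply: cvgB; first exact: cvg_cst.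
    by apply: cvgM; [exact: cv|exact: cvg_cst].
  apply: cvgM; first exact: cvg_cst.
  by rewrite !expr2; apply: cvgM; exact: cv.
Unshelve. all: by end_near. Qed.

End normal_gap.

(** * The gap for the uniform law *)

Lemma cvg_natrV (R : realType) : (N%:R^-1 : R) @[N --> \oo] --> (0 : R).
Proof.
apply/(gtr0_cvgV0 (f := fun N : nat => N%:R : R)); last exact: cvgr_idn.
by near=> N; rewrite ltr0n; near: N; exact: nbhs_infty_gt.
Unshelve. all: by end_near. Qed.

Lemma cvg_expr_expR (R : realType) (r : R) : 0 <= r ->
  (1 - r / N%:R) ^+ N @[N --> \oo] --> expR (- r).
Proof.
move=> r0; have crN : r / N%:R @[N --> \oo] --> (0 : R).
  by rewrite -[0 in X in _ --> X](mulr0 r); apply: cvgM; [exact: cvg_cst|exact: cvg_natrV].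
apply: (squeeze_cvgr (f := fun N => expR (- (r * (1 - r / N%:R)^-1)))
  (h := fun=> expR (- r))); last exact: cvg_cst.
  near=> N.
  have N0 : (0 : R) < N%:R by rewrite ltr0n; near: N; exact: nbhs_infty_gt.
  have rN : r < N%:R by near: N; exact: nbhs_infty_gtr.
  set z := r / N%:R.
  have z1 : 0 < 1 - z by rewrite subr_gt0 ltr_pdivrMr// mul1r.
  have NzE : N%:R * z = r by rewrite mulrC divfK// gt_eqF.
  apply/andP; split; last first.
    apply: le_trans (expr_le_expR N (ltW z1)) _.
    by rewrite opprB addrC subrK NzE.
  (* The lower bound is [1 / (1 - z) = 1 + z / (1 - z) <= exp (z / (1 - z))], inverted and raised to
     the power [N]. *)
  have -> : expR (- (r * (1 - z)^-1)) = expR (- (z / (1 - z))) ^+ N.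
    by rewrite -expRM_natl mulrN mulrA NzE.
  rewrite lerXn2r ?nnegrE ?expR_ge0 ?(ltW z1)// expRN invf_ple ?posrE ?expR_gt0//.
  apply: le_trans (expR_ge1Dx _); rewrite le_eqVlt; apply/orP; left; apply/eqP.
  by field; rewrite gt_eqF.
rewrite -[X in expR (- X)]mulr1 -[X in r * X]invr1 -[X in X^-1]subr0.
apply: (cvg_comp _ expR); last exact: continuous_expR.
apply: cvgN; apply: cvgM; first exact: cvg_cst.
apply: cvgV; first by rewrite subr0 oner_eq0.
by apply: cvgB => //; exact: cvg_cst.
Unshelve. all: by end_near. Qed.

(** With [s = r / N] and [U = 1 - s], the tail [1 - (y + s)] equals [F U - F y] for all [y <= U].
    Both comparisons hold with factor 1, and the gap has probability exactly [(1 - r / N)^N] once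
    [N > r]. *)
Lemma cvg_uniform_gap (R : realType) (d : nat -> measure_display)
    (T : forall N, measurableType (d N)) (P : forall N, probability (T N) R)
    (X : forall N, 'I_N -> {RV (P N) >-> R}) (r : R) :
  (forall N, iid_with_law (@X N) (uniform_prob (@ltr01 R))) -> 0 <= r ->
  P N (gap_event (@X N) (r / N%:R)) @[N --> \oo] --> (expR (- r))%:E.
Proof.
move=> iidX r0.
apply: (@cvg_trans _ (((1 - r / N%:R) ^+ N)%:E @[N --> \oo])); last first.
  by apply: cvg_EFin; [exact: nearW|exact: cvg_expr_expR].
apply: near_eq_cvg; near=> N.
have N0 : (0 < N)%N by near: N; exact: nbhs_infty_gt.
have rN : r < N%:R by near: N; exact: nbhs_infty_gtr.
have NR0 : (0 : R) < N%:R by rewrite ltr0n.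
set s := r / N%:R.
have s0 : 0 <= s by rewrite divr_ge0.
have s1 : s < 1 by rewrite ltr_pdivrMr// mul1r.
have U0 : 0 <= 1 - s by rewrite subr_ge0 ltW.
have muF c : 0 <= c -> uniform_prob (@ltr01 R) [set x | `|x| <= c] = (Num.min c 1)%:E.
  exact: uniform_abs_le.
have atom c (_ : 0 <= c) := @uniform_abs_atom R c.
have minU : Num.min (1 - s) 1 = 1 - s by apply/min_idPl; rewrite gerBl.
have minl c : c <= 1 -> Num.min c 1 = c by move=> ?; apply/min_idPl.
apply/eqP; rewrite eq_le; apply/andP; split.
  have := prob_gap_lower (iidX N) N0 muF atom ler01 U0 s0.
  rewrite mul1r minU; apply => y /andP[y0 yU].
  have y1 : y + s <= 1 by rewrite -lerBrDr.
  have yl1 : y <= 1 by rewrite (le_trans yU)// gerBl.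
  by rewrite mul1r !minl//; lra.
have := prob_gap_upper_le (iidX N) N0 muF atom ler01 U0 s0.
rewrite mul1r minU; apply => y.
  move=> /andP[y0 yU]; have y1 : y + s <= 1 by rewrite -lerBrDr.
  have yl1 : y <= 1 by rewrite (le_trans yU)// gerBl.
  by rewrite mul1r !minl//; lra.
by move=> yU; apply/min_idPr; rewrite -lerBlDr ltW.
Unshelve. all: by end_near. Qed.

Theorem theorem2p4 (R : realType) (lam : rat) (hlam : 0 < lam) (y : R)
    (d : nat -> measure_display) (T : forall N, measurableType (d N))
    (P : forall N, probability (T N) R)
    (A : forall N, 'I_N -> {RV (P N) >-> R}) :
  let C (N : nat) (w : T N) : \bar R :=
    condUL (ratr lam) (const_mx y : 'cV[R]_1) (random_row (A N) w) in
  [/\ (forall N, iid_with_law (A N) (exponential_prob (1 : R))) ->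
      forall t : R, 0 < t ->
        P N [set w | ((1 / t)%:E < C N w)%E] @[N --> \oo] -->
          (if t < `|y| then (1 - expR (- (2 * t)))%:E else 1%E),

      forall mu sigma : R, 0 < sigma -> y != 0 ->
        (forall N, iid_with_law (A N) (normal_prob mu sigma)) ->
        cvg_in_distribution P
          (fun N w => (2 * Num.sqrt (2 * ln N%:R))%:E * (C N w)^-1)%E
          (exponential_prob (1 / sigma))
    & ratr lam / 2 < `|y| ->
        (forall N, iid_with_law (A N) (uniform_prob (@ltr01 R))) ->
        cvg_in_distribution P
          (fun N w => (2 * N%:R)%:E * (C N w)^-1)%E
          (exponential_prob 1)].
Proof.
move=> C; have lam0 : 0 < ratr lam :> R by rewrite ltr0q.
have CE N : C N = fun w => condUL (ratr lam) (const_mx y) (random_row (A N) w) by [].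
have CV N w : ((C N w)^-1)%E = stsp (ratr lam) (const_mx y) (random_row (A N) w).
  by rewrite CE condULV.
(* The stability support is half the gap; this cancels the factor 2 of the normalising sequences. *)
have halve (a b : R) : 2 * (a / (2 * b)) = a / b by rewrite invfM mulrCA mulVKf.
split.
- move=> iidA t t0.
  rewrite (_ : (fun N => P N _) = fun N => P N [set w |
      (stsp (ratr lam) (const_mx y) (random_row (A N) w) < t%:E)%E]); last first.
    apply/funext => N; congr (P N _); apply/seteqP; split=> w /=;
      by rewrite CE condUL_gtE.
  have F1 (c : R) : 1 - expR (- c) < 1 by rewrite gtrBl expR_gt0.
  have muF := @exponential_abs_le R.
  case: ifPn => [ty|]; last first.
    rewrite -leNgt => yt.
    exact: (cvg_prob_stsp_lt_large lam0 iidA muF t0 yt (lexx _) (F1 _)).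
  have t0y : 0 < t < `|y| by rewrite t0.
  apply: (cvg_prob_stsp_lt_gap lam0 iidA muF _ t0y (lexx _) (F1 _)).
    by move=> c _; exact: exponential_abs_atom.
  (* For the exponential law the probability of the gap does not depend on [N] once the row is
     nonempty. *)
  apply: cvg_near_cst; near=> N.
  have N0 : (0 < N)%N by near: N; exact: nbhs_infty_gt.
  have oneK (x : R) : 1 - (1 - x) = x by rewrite opprB addrC subrK.
  apply: (prob_gap_memoryless (iidA N) N0 muF).
  + by move=> c _; exact: exponential_abs_atom.
  + exact: expR_gt0.
  + by rewrite mulr_ge0// ltW.
  + by move=> z _; rewrite !oneK -expRD opprD addrC.
- move=> mu sigma sigma0 y0 iidA r _.
  have y0' : 0 < `|y| by rewrite normr_gt0.
  have cu := @cvg_sqrt2ln R.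
  have K0 : \forall N \near \oo, 0 < 2 * sqrt2ln N :> R.
    near=> N; rewrite mulr_gt0//; near: N; move/cvgryPgt: cu; exact.
  rewrite exponential_prob_itvNyc ?divr_gt0//.
  under eq_fun do under eq_set do rewrite CV.
  case: ifPn => [r0|]; last first.
    by rewrite -ltNge => r0; exact: cvg_prob_scaled_stsp_le_lt0.
  (* The threshold of [amax_robust] for [tau = |y| / 2]. Any fixed [tau] strictly between 0 and
     [|y|] would do, because the entries are unbounded and [r / K N] tends to 0. *)
  pose c := `|y| / 2 + ratr lam / (2 * (`|y| - `|y| / 2)).
  have muF := @normal_abs_le R sigma sigma0 mu.
  have c0 : 0 <= c.
    have half0 : 0 <= `|y| - `|y| / 2 by lra.
    apply: addr_ge0; first by rewrite divr_ge0.
    by apply: divr_ge0; [exact: ltW|exact: mulr_ge0].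
  have Fc : normal_abs_cdf sigma mu c < 1.
    rewrite gtrBl ltr_pwDl ?fine_ge0 ?normal_tail_ge0//.
    rewrite -lte_fin fineK ?normal_tail_fin//.
    apply: lt_le_trans (normal_tail_ge sigma0 mu c0).
    by rewrite lte_fin mulr_gt0 ?expR_gt0// normal_peak_gt0// gt_eqF.
  apply: (@cvg_prob_scaled_stsp_le _ _ _ _ _ y lam0 A _ iidA _ muF
    (fun N => 2 * sqrt2ln N) (`|y| / 2) c) => //.
  + by apply/andP; split; lra.
  + near=> N; have uN : 0 < sqrt2ln N :> R by near: N; move/cvgryPgt: cu; exact.
    rewrite ltr_pdivrMr ?mulr_gt0// mulrA divfK// mulrC.
    rewrite -ltr_pdivrMr//; near: N; move/cvgryPgt: cu; exact.
  + under eq_fun do rewrite halve.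
    exact: (cvg_normal_gap sigma0 iidA r0).
- move=> ylam iidA r _.
  have K0 : \forall N \near \oo, (0 : R) < 2 * N%:R.
    by near=> N; rewrite mulr_gt0// ltr0n; near: N; exact: nbhs_infty_gt.
  rewrite exponential_prob_itvNyc// mul1r.
  under eq_fun do under eq_set do rewrite CV.
  case: ifPn => [r0|]; last first.
    by rewrite -ltNge => r0; exact: cvg_prob_scaled_stsp_le_lt0.
  have y0 := normr_ge0 y.
  (* The threshold [c] must stay below 1, that is, [lam < 2 (1 - tau) (|y| - tau)]. With this choice
     the right-hand side is [|y| + lam / 2 + 2 tau^2], which exceeds [lam] because
     [lam / 2 < |y|]. *)
  pose tau : R := (`|y| - ratr lam / 2) / (2 * (1 + `|y|)).
  have y1 : 0 < 2 * (1 + `|y|) by lra.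
  have tauE : tau * (2 * (1 + `|y|)) = `|y| - ratr lam / 2 by rewrite divfK// gt_eqF.
  have tau0 : 0 < tau by rewrite divr_gt0// subr_gt0.
  have tau1 : tau < 1 by rewrite ltr_pdivrMr//; lra.
  have tauy : tau < `|y| by nra.
  pose c := tau + ratr lam / (2 * (`|y| - tau)).
  have Fc : Num.min c 1 < 1.
    rewrite gt_min ltxx orbF /c -ltrBrDl ltr_pdivrMr ?mulr_gt0 ?subr_gt0//.
    by nra.
  apply: (@cvg_prob_scaled_stsp_le _ _ _ _ _ y lam0 A _ iidA _ (@uniform_abs_le R)
    (fun N => 2 * N%:R) tau c) => //.
  + by rewrite tau0.
  + near=> N; have uN : (0 : R) < N%:R by rewrite ltr0n; near: N; exact: nbhs_infty_gt.
    rewrite ltr_pdivrMr ?mulr_gt0// mulrA mulrC -ltr_pdivrMr 1?mulr_gt0//.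
    by near: N; exact: nbhs_infty_gtr.
  + under eq_fun do rewrite halve.
    exact: (cvg_uniform_gap iidA r0).
Unshelve. all: by end_near. Qed.
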